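(* Let $\eta>1$ and $2<s<4$. There exists a sequence of i.i.d. real random variables $(X_n)_{n\ge1}$ with $\mathbf E X_1=0$, $\mathbf E X_1^2=1$, $\mathbf E|X_1|^s<+\infty$ and $D(X_1)<+\infty$, such that for $Z_n=(X_1+\dots+X_n)/\sqrt n$, $$D(Z_n)\ge\frac{c(\eta)}{(n\log n)^{(s-2)/2}(\log n)^{\eta}}\qquad\text{for all } n\ge n_1(X_1),$$ where $c(\eta)>0$ is a constant depending only on $\eta$ and $n_1(X_1)$ depends on the distribution of $X_1$.
   Context: $D(X)=\int p\log(p/\varphi_{a,\sigma})$ is the relative entropy of $X$ (with density $p$, mean $a$, variance $\sigma^2$) with respect to the normal law $N(a,\sigma^2)$ with density $\varphi_{a,\sigma}$. *)

(* Defs.v *)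
From HB Require Import structures.
From mathcomp Require Import all_boot all_order all_algebra.
From mathcomp Require Import all_classical all_reals all_analysis.
Set Implicit Arguments. Unset Strict Implicit. Unset Printing Implicit Defensive.
Import Order.TTheory GRing.Theory Num.Theory.
Import numFieldNormedType.Exports.
Local Open Scope classical_set_scope.
Local Open Scope ring_scope.

Section defs.
Context {d : measure_display} {T : measurableType d} {R : realType}.
Variable P : probability T R.

Definition mutually_independent (X : nat -> T -> R) : Prop :=
  forall (I : seq nat) (B : nat -> set R), uniq I ->
    (forall i, measurable (B i)) ->
    P (\bigcap_(i in [set` I]) (X i @^-1` B i)) =
    (\prod_(i <- I) P (X i @^-1` B i))%E.

Definition identically_distributed (X : nat -> T -> R) : Prop :=
  forall n (A : set R), measurable A -> P (X n @^-1` A) = P (X 0%N @^-1` A).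

Definition iid (X : nat -> T -> R) : Prop :=
  mutually_independent X /\ identically_distributed X.

Definition is_density (f : T -> R) (p : R -> R) : Prop :=
  [/\ measurable_fun setT p, (forall x, 0 <= p x) &
      forall A : set R, measurable A ->
        P (f @^-1` A) = (\int[lebesgue_measure]_(x in A) (p x)%:E)%E].

(* int p log (p / phi_{a,sigma}) (with 0 log 0 = 0) *)
Definition rel_entropy_normal (p : R -> R) (a sigma : R) : \bar R :=
  (\int[lebesgue_measure]_x ((p x) * ln (p x / normal_pdf a sigma x))%:E)%E.

(* D(f): relative entropy of f w.r.t. the normal law with the same mean a
   and variance sigma^2; +oo if f has no density (densities are a.e. unique,
   so the infimum is over a set with one value). *)
Definition D (f : T -> R) : \bar R :=
  let a := fine ('E_P[f])%E in
  let sigma := Num.sqrt (fine ('V_P[f])%E) in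
  ereal_inf [set rel_entropy_normal p a sigma | p in is_density f].

End defs.

(* Z_n = (X_1 + ... + X_n)/sqrt n, with X_k written X (k-1) *)
Definition normalized_sum {d : measure_display} {T : measurableType d}
  {R : realType} (X : nat -> T -> R) (n : nat) : T -> R :=
  fun w => (\sum_(i < n) X i w) / Num.sqrt n%:R.

(* Main.v *)
Require Import Defs.
From HB Require Import structures.
From mathcomp Require Import all_boot all_order all_algebra.
From mathcomp Require Import all_classical all_reals all_analysis.
From mathcomp Require Import measurable_realfun ring lra.
Set Implicit Arguments. Unset Strict Implicit. Unset Printing Implicit Defensive.
Import Order.TTheory GRing.Theory Num.Theory.
Import numFieldNormedType.Exports.
Local Open Scope classical_set_scope.
Local Open Scope ring_scope.

(** Take [X] symmetric with a bounded density, variance 1 and a tail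
    [P(|X| > t)] of order [t^-s (log t)^-eta]; since [eta > 1] the [s]-th moment
    is finite. For [t = sqrt (12 n log n)], symmetry and a single big jump give
    [P(|X_1 + ... + X_n| > t) >= n P(X > t) / 2], so [Z_n] exceeds
    [sqrt (12 log n)] with a probability [pi] of order
    [n (n log n)^(-s/2) (log n)^-eta >= n^(-1-o(1))], whereas the standard normal
    law does so with probability [O(n^-3)]. By the variational formula for
    relative entropy any such discrepancy forces
    [D(Z_n) >= pi log n - O(n^-2)], which is the announced lower bound; since [D]
    is an infimum over densities, [Z_n] need not be shown to have one.

    The i.i.d. sequence lives on the space of coin tossing sequences: the
    even-indexed bits produce [X_1] through its quantile function, and the
    odd-indexed bits are again a fair coin tossing sequence from which the
    remaining variables are produced in the same way. *)

(** The constant may depend on [eta] alone, and this dictates the density. Its tail is scaled so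
    that the tail part has [s]-th absolute moment 1/2 for every [s], which puts the factor
    [(eta - 1) / 4], free of [s], in front of the tail. The only other factor depending on [s] is
    [48 ^ (s / 2)], at most [48 ^ 2] because [s < 4]. The bound [s < 4] also keeps the main term
    above a multiple of [(n log n)^-1 (log n)^-eta], so half of it absorbs an error of order [n^-2].
    The 12 in [t] comes from the entropy estimate: weighting the tail event by [log n] costs
    [sqrt 2 * exp (log n - t^2 / (4 n))], which is [sqrt 2 / n^2] when [t^2 = 12 n log n]. The 48 is
    four times 12, since the tail beyond [t] is estimated by the mass of []t, 2 t]]. The other
    summands must not undo a big jump. Symmetry takes care of this: whatever the sign of their sum,
    a jump of that sign is as likely as one of the opposite sign. *)

(** * Measures determined on a pi-system *)

Lemma eq_measure_pi_system d (T : measurableType d) (R : realType)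
    (G : set (set T)) (m1 m2 : {measure set T -> \bar R}) :
  measurable = <<s G >> -> setI_closed G -> G setT ->
  (forall A, G A -> m1 A = m2 A) -> (m1 setT < +oo)%E ->
  forall A, measurable A -> m1 A = m2 A.
Proof.
move=> mG GI GT m12 m1oo A mA.
apply: (measure_unique G (fun=> setT)) => //.
by rewrite bigcup_const//; exists 0%N.
Qed.

(** Both sides are finite measures in [A]: the image under [f] of [P] restricted to [B], and [k]
    times [Q]. When [Q] is the law of [f] and [k] is the probability of [B], this is the
    independence of [B] and [f]. *)
Lemma eq_preimage_pi_system d d' (T : measurableType d) (U : measurableType d')
    (R : realType) (P : probability T R) (f : T -> U)
    (mf : measurable_fun setT f) (B : set T) (mB : measurable B)
    (Q : probability U R) (G : set (set U)) (k : R) : 0 <= k ->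
  measurable = <<s G >> -> setI_closed G -> G setT ->
  (forall A, G A -> P (B `&` f @^-1` A) = (k%:E * Q A)%E) ->
  forall A, measurable A -> P (B `&` f @^-1` A) = (k%:E * Q A)%E.
Proof.
move=> k0 mG GI GT h A mA.
pose m1 : {measure set U -> \bar R} := pushforward (mrestr P mB) f.
pose m2 : {measure set U -> \bar R} := mscale (NngNum k0) Q.
have h12 : m1 mf A = m2 A.
  apply: (eq_measure_pi_system mG) => // [C GC|].
    by rewrite /m1/= /pushforward /mrestr /m2/= /mscale/= setIC h.
  rewrite /m1/= /pushforward /mrestr.
  by rewrite -ge0_fin_numE// fin_num_measure//= preimage_setT setTI.
by move: h12; rewrite /m1/= /pushforward /mrestr /m2/= /mscale/= setIC.
Qed.

(** * Fair coin tossing *)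

Section cantor_space.

Definition cylinder (l : seq bool) : set (nat -> bool) :=
  [set x | forall k, (k < size l)%N -> x k = nth false l k].

(** Of two prefixes, either one extends the other or they disagree at some place; the empty set is
    included for the second case, so that the family is closed under intersection. *)
Definition cylinders : set (set (nat -> bool)) :=
  [set A | A = set0 \/ exists l, A = cylinder l].

Definition cantor := g_sigma_algebraType cylinders.

HB.instance Definition _ := Measurable.copy cantor (g_sigma_algebraType cylinders).

Definition ctail (x : nat -> bool) : nat -> bool := fun k => x k.+1.
Definition ceven (x : nat -> bool) : nat -> bool := fun k => x k.*2.
Definition codd (x : nat -> bool) : nat -> bool := fun k => x k.*2.+1.

Lemma cylinder0 : cylinder [::] = setT.
Proof. by apply/seteqP; split. Qed.

Lemma cylinder_cons e l x : cylinder (e :: l) x <-> x 0%N = e /\ cylinder l (ctail x).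
Proof.
split=> [h|[x0 h] [|k]//]; last exact: h.
by split=> [|k kl]; [exact: (h 0%N)|exact: (h k.+1)].
Qed.

Lemma setI_closed_cylinders : setI_closed cylinders.
Proof.
move=> A B [->|[l ->]]; first by rewrite set0I; left.
case=> [->|[l' ->]]; first by rewrite setI0; left.
wlog ll' : l l' / (size l <= size l')%N.
  move=> h; have [/h//|/ltnW/h] := leqP (size l) (size l').
  by rewrite setIC.
have [e|ne] := eqVneq (take (size l) l') l.
  right; exists l'; apply/seteqP; split=> [x [] //|x xl']; split => // k kl.
  by rewrite xl' ?(leq_trans kl)// -[in RHS]e nth_take.
left; rewrite -subset0 => x [xl xl'] /=; move/eqP: ne; apply.
apply: (@eq_from_nth _ false); first by rewrite size_takel.
move=> k; rewrite size_takel// => kl; rewrite nth_take// -xl// xl'//.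
exact: leq_trans ll'.
Qed.

Lemma cylindersT : cylinders setT.
Proof. by right; exists [::]; rewrite cylinder0. Qed.

Lemma measurable_cylinder l : measurable (cylinder l : set cantor).
Proof. by apply: sub_sigma_algebra; right; exists l. Qed.

Lemma measurable_ctail : measurable_fun [set: cantor] (ctail : cantor -> cantor).
Proof.
apply: (@measurability _ _ cantor cantor setT ctail cylinders) => // _ [_ [->|[l ->]] <-].
  by rewrite preimage_set0 setI0; exact: measurable0.
rewrite (_ : _ `&` _ = cylinder (false :: l) `|` cylinder (true :: l)); last first.
  apply/seteqP; split=> [x [_ xl]|x [] /cylinder_cons[]//].
  case x0 : (x 0%N); [right|left]; exact/cylinder_cons.
by apply: measurableU; exact: measurable_cylinder.
Qed.

Lemma measurable_ccoord k : measurable_fun [set: cantor] (fun x : cantor => x k).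
Proof.
elim: k => [|k ih]; last exact: measurableT_comp ih measurable_ctail.
apply: (@measurable_fun_bool _ _ _ _ true).
rewrite setTI (_ : _ @^-1` _ = cylinder [:: true]); first exact: measurable_cylinder.
by apply/seteqP; split => [x x0 [|k]//|x /(_ 0%N)]; exact.
Qed.

Lemma measurable_fun_cantor d (T : measurableType d) (f : T -> cantor) :
  (forall k, measurable_fun setT (fun t => f t k)) -> measurable_fun setT f.
Proof.
move=> mf; apply: (@measurability _ _ T cantor setT f cylinders) => // _ [_ [->|[l ->]] <-].
  by rewrite preimage_set0 setI0; exact: measurable0.
rewrite setTI (_ : _ @^-1` _ =
    \bigcap_(k < size l) ((fun t => f t k) @^-1` [set nth false l k])); last first.
  by apply/seteqP; split=> x /=.
apply: bigcap_measurableType => k _.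
by rewrite -[X in measurable X]setTI; exact: mf.
Qed.

Lemma measurable_ceven : measurable_fun [set: cantor] (ceven : cantor -> cantor).
Proof. by apply: measurable_fun_cantor => k; exact: measurable_ccoord. Qed.

Lemma measurable_codd : measurable_fun [set: cantor] (codd : cantor -> cantor).
Proof. by apply: measurable_fun_cantor => k; exact: measurable_ccoord. Qed.

End cantor_space.

(** * Binary expansions of points of the unit interval *)

Section binary_digits.
Context {R : realType}.
Implicit Type x : R.

(** On [[0, 1)] this is doubling modulo 1, whose orbits read off binary digits. The comparison with
    1/2 being weak, dyadic numbers receive the expansion that ends in zeros. *)
Definition dbl x : R := if 2^-1 <= x then 2 * x - 1 else 2 * x.

Definition digits x : cantor := fun k => 2^-1 <= iter k dbl x.

(** Left endpoint of the dyadic interval of the numbers whose expansion starts with [l]. *)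
Definition bin_start (l : seq bool) : R :=
  foldr (fun (e : bool) v => (e%:R + v) / 2) 0 l.

Definition bin_value (w : cantor) : R :=
  limn (fun n => \sum_(k < n) (w k)%:R / 2 ^+ k.+1 : R).

Lemma dbl_itv x : 0 <= x < 1 -> 0 <= dbl x < 1.
Proof. by rewrite /dbl; case: ifPn => h; lra. Qed.

Lemma iter_dbl_itv k x : 0 <= x < 1 -> 0 <= iter k dbl x < 1.
Proof. by move=> x01; elim: k => //= k; exact: dbl_itv. Qed.

Lemma ctail_digits x : ctail (digits x) = digits (dbl x).
Proof. by apply/funext => k; rewrite /ctail /digits iterSr. Qed.

Lemma measurable_dbl : measurable_fun setT dbl.
Proof.
apply: measurable_fun_ifT => //.
  exact: measurable_fun_ler.
by apply: measurable_funB => //; exact: measurable_funM.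
Qed.

Lemma measurable_digits : measurable_fun setT digits.
Proof.
apply: measurable_fun_cantor => k; apply: measurable_fun_ler => //.
elim: k => [|k ih]; first exact: measurable_id.
exact: (measurableT_comp measurable_dbl ih).
Qed.

Lemma bin_start_itv l : 0 <= bin_start l /\ bin_start l + 2^-1 ^+ size l <= 1.
Proof.
elim: l => [|e l []] /=; first by rewrite expr0; lra.
by rewrite exprS; case: e => /=; lra.
Qed.

(** Induction on the prefix with [x] free, because dropping the first digit of [x] gives the digits
    of [dbl x]. *)
Lemma cylinder_digits l x : 0 <= x < 1 ->
  cylinder l (digits x) <-> bin_start l <= x < bin_start l + 2^-1 ^+ size l.
Proof.
elim: l x => [|e l ih] x x01; first by rewrite cylinder0 expr0 add0r x01.
rewrite (@propext _ _ (cylinder_cons e l (digits x))) ctail_digits.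
rewrite (@propext _ _ (ih _ (dbl_itv x01))) /digits /= /dbl exprS.
have := bin_start_itv l.
move: (bin_start l) (2^-1 ^+ size l) => a b [a0 ab].
case: ifPn => h; case: e => /=; rewrite ?mulr1n ?mulr0n; split => [[]|] //.
- by move=> _; lra.
- by move=> h1; split => //; lra.
- by move=> h1; exfalso; lra.
- by move=> h1; exfalso; lra.
- by move=> _; lra.
- by move=> h1; split; [exact/negbTE|]; lra.
Qed.

Lemma bin_value_digits x : 0 <= x < 1 -> bin_value (digits x) = x.
Proof.
move=> x01; apply/cvg_lim => //.
(* The partial sum misses [x] by exactly the [n]-th iterate of [dbl] scaled by [2^-n], hence by at
   most [2^-n]. *)
have e n : \sum_(k < n) (digits x k)%:R / 2 ^+ k.+1 = x - iter n dbl x * 2^-1 ^+ n.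
  elim: n => [|n ih]; first by rewrite big_ord0/= expr0 mulr1 subrr.
  rewrite big_ord_recr/= ih /digits exprS invfM exprS exprVn.
  move: (iter n dbl x) (2 ^+ n)^-1 => y z; rewrite /dbl.
  by case: ifPn => _ /=; field.
suff i0 : (fun n => iter n dbl x * 2^-1 ^+ n) @ \oo --> (0 : R).
  rewrite (_ : (fun n => _) = (fun n => x - iter n dbl x * 2^-1 ^+ n)); last first.
    exact/funext.
  rewrite -[x in _ --> x](subr0 x).
  by apply: (@cvgB _ R^o) => //; exact: cvg_cst.
apply: (@squeeze_cvgr _ _ _ _ (cst 0) (fun n => 2^-1 ^+ n)).
- apply: nearW => n; have := iter_dbl_itv n x01 => /andP[i0 i1].
  by rewrite mulr_ge0 ?exprn_ge0//= ler_piMl ?exprn_ge0// ltW.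
- exact: cvg_cst.
- by apply: cvg_expr; rewrite ger0_norm; lra.
Qed.

Lemma measurable_bin_value : measurable_fun setT bin_value.
Proof.
apply: (@measurable_fun_cvg _ _ _ _
  (fun n w => \sum_(k < n) ((w : cantor) k)%:R / 2 ^+ k.+1)) => [n|w _].
  apply: measurable_sum => k; apply: measurable_funM => //.
  have : (fun w : cantor => (w k)%:R : R) = (fun w => if w k then 1 else 0).
    by apply/funext => w; case: (w k).
  by move=> ->; apply: measurable_fun_ifT => //; exact: measurable_ccoord.
apply: nondecreasing_is_cvgn.
  apply/nondecreasing_seqP => n; rewrite big_ord_recr/= lerDl.
  by rewrite divr_ge0.
exists 1 => _ [n _ <-].
(* The bound 1 is sharpened to [1 - 2^-n] to make the induction go through. *)
have : \sum_(k < n) (w k)%:R / 2 ^+ k.+1 <= 1 - 2^-1 ^+ n :> R.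
  elim: n => [|n ih]; first by rewrite big_ord0 expr0 subrr.
  rewrite big_ord_recr/=.
  have : (w n)%:R / 2 ^+ n.+1 <= 2^-1 ^+ n.+1 :> R.
    by rewrite exprVn ler_piMl//; case: (w n).
  move: (_ / 2 ^+ n.+1) ih => a; rewrite exprS; lra.
by move=> /le_trans; apply; rewrite gerBl exprn_ge0.
Qed.

End binary_digits.

(** * The fair coin measure *)

Section coin_tossing.
Context {R : realType}.
Local Notation unif := (uniform_prob (@ltr01 R)).

(** The point 1 is discarded as a null set, since the results on digits concern the half-open
    interval. *)
Lemma uniform_prob01E (A : set R) : measurable A ->
  unif A = lebesgue_measure (A `&` `[0, 1[).
Proof.
move=> mA; rewrite /uniform_prob integral_uniform_pdf.
rewrite (eq_integral (fun=> 1%E)); last first.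
  move=> x; rewrite inE/= in_itv/= /uniform_pdf => -[_ ->].
  by rewrite subr0 invr1.
rewrite integral_cst ?mul1e//; last exact: measurableI.
apply/eqP; rewrite eq_le; apply/andP; split; last first.
  rewrite le_measure ?inE//; try exact: measurableI.
  by apply: setIS; apply: subset_itvl; rewrite bnd_simp.
rewrite (_ : A `&` `[0, 1] =
    (A `&` `[0, 1[) `|` (A `&` `[0, 1] `&` [set 1])); last first.
  apply/seteqP; split=> x /=; rewrite !in_itv/=.
    move=> [Ax /andP[x0 x1]]; have [xe|xn] := eqVneq x 1.
      by right; rewrite xe in Ax *; rewrite ler01 lexx.
    by left; rewrite x0 lt_neqAle xn.
  move=> [[Ax /andP[-> /ltW->]]//|[[Ax ->]]//].
have mA1 : measurable (A `&` `[0, 1] `&` [set 1]).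
  by apply: measurableI => //; exact: measurableI.
apply: (le_trans (measureU2 _ _ _)) => //=; first exact: measurableI.
rewrite [X in (_ + X)%E](_ : _ = 0)%E ?adde0//.
apply/eqP; rewrite -measure_le0.
rewrite (le_trans (le_measure _ _ _ (@subIsetr _ _ _)))//= ?inE//.
by rewrite lebesgue_measure_set1.
Qed.

HB.instance Definition _ := @isMeasurableFun.Build _ _ _ _
  (@digits R : measurableTypeR R -> cantor) (@measurable_digits R).

(** Instead of an infinite product, the image of Lebesgue measure under binary expansion. The
    product structure is recovered from the measure [2^-k] of a cylinder of length [k]. *)
Definition coin : probability cantor R :=
  distribution unif (@digits R : {mfun measurableTypeR R >-> cantor}).

Lemma coinE (A : set cantor) : coin A = unif (@digits R @^-1` A).
Proof. by []. Qed.

Lemma coin_cylinder l : coin (cylinder l) = (2^-1 ^+ size l)%:E.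
Proof.
have mD : measurable (@digits R @^-1` cylinder l).
  rewrite -[X in measurable X]setTI; apply: measurable_digits => //.
  exact: measurable_cylinder.
rewrite coinE uniform_prob01E//.
have [b0 b1] := @bin_start_itv R l.
rewrite (_ : _ `&` _ = `[bin_start l, bin_start l + 2^-1 ^+ size l[%classic).
  rewrite lebesgue_measure_itv/= lte_fin ltrDl exprn_gt0//.
  by rewrite -EFinB addrAC subrr add0r.
apply/seteqP; split=> x /=; rewrite !in_itv/=.
  by move=> [+ x01]; rewrite (@propext _ _ (cylinder_digits l x01)).
move=> /andP[bx xb].
have x01 : 0 <= x < 1 by rewrite (le_trans b0)//= (lt_le_trans xb).
by split=> //; apply/cylinder_digits => //; rewrite bx.
Qed.

Lemma measurable_ctail_eq e (A : set cantor) : measurable A ->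
  measurable ([set x : cantor | x 0%N = e /\ A (ctail x)]).
Proof.
move=> mA; rewrite (_ : [set x | _] = (fun x : cantor => x 0%N) @^-1` [set e] `&`
    (ctail : cantor -> cantor) @^-1` A); last by apply/seteqP; split.
apply: measurableI.
  by rewrite -[X in measurable X]setTI; exact: measurable_ccoord.
by rewrite -[X in measurable X]setTI; exact: measurable_ctail.
Qed.

Lemma coin_cons e (A : set cantor) : measurable A ->
  coin [set x : cantor | x 0%N = e /\ A (ctail x)] = (2^-1%:E * coin A)%E.
Proof.
move=> mA.
have me : measurable ([set x : cantor | x 0%N = e]).
  rewrite (_ : [set x | _] = (fun x : cantor => x 0%N) @^-1` [set e])//.
  by rewrite -[X in measurable X]setTI; exact: measurable_ccoord.
have -> : [set x : cantor | x 0%N = e /\ A (ctail x)] =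
    [set x : cantor | x 0%N = e] `&` (ctail : cantor -> cantor) @^-1` A by [].
apply: (@eq_preimage_pi_system _ _ _ _ _ _ _ measurable_ctail _ me _ cylinders) => //.
- exact: setI_closed_cylinders.
- exact: cylindersT.
- move=> _ [->|[l ->]]; first by rewrite preimage_set0 setI0 !measure0 mule0.
  rewrite (_ : _ `&` _ = cylinder (e :: l)); last first.
    by apply/seteqP; split=> x /=; rewrite (@propext _ _ (cylinder_cons e l x)).
  by rewrite !coin_cylinder/= exprS.
Qed.

Lemma coin_ctail (A : set cantor) : measurable A ->
  coin ((ctail : cantor -> cantor) @^-1` A) = coin A.
Proof.
move=> mA; rewrite (_ : _ @^-1` _ = [set x : cantor | x 0%N = true /\ A (ctail x)] `|`
    [set x : cantor | x 0%N = false /\ A (ctail x)]); last first.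
  apply/seteqP; split=> [x /= Ax|x /= [][]//].
  by case: (x 0%N); [left|right].
rewrite measureU; [|exact: measurable_ctail_eq|exact: measurable_ctail_eq|].
  transitivity (2^-1%:E * coin A + 2^-1%:E * coin A)%E.
    by congr (_ + _)%E; exact: coin_cons.
  rewrite -ge0_muleDl ?lee_fin ?invr_ge0//.
  by rewrite -EFinD -[2^-1]mul1r -splitr mul1e.
by rewrite -subset0 => x /= [[-> _] []].
Qed.

(* [codd] is [ceven] after [ctail], and [ctail] of [ceven x] is [codd] of
   [ctail x]: removing the first bit exchanges the two halves, so the induction
   is on the total number of prescribed bits. *)
Lemma coin_split_cylinder l l' :
  coin ((ceven : cantor -> cantor) @^-1` cylinder l `&`
        (codd : cantor -> cantor) @^-1` cylinder l') =
  (2^-1 ^+ size l * 2^-1 ^+ size l')%:E.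
Proof.
have mI u v : measurable ((ceven : cantor -> cantor) @^-1` cylinder u `&`
    (codd : cantor -> cantor) @^-1` cylinder v).
  apply: measurableI; rewrite -[X in measurable X]setTI.
    by apply: measurable_ceven => //; exact: measurable_cylinder.
  by apply: measurable_codd => //; exact: measurable_cylinder.
have step e u v : coin ((ceven : cantor -> cantor) @^-1` cylinder (e :: u) `&`
      (codd : cantor -> cantor) @^-1` cylinder v) =
    (2^-1%:E * coin ((ceven : cantor -> cantor) @^-1` cylinder v `&`
      (codd : cantor -> cantor) @^-1` cylinder u))%E.
  rewrite -(coin_cons e)//; congr (coin _).
  apply/seteqP; split=> x /=.
    by move=> [/cylinder_cons[x0 xu] xv].
  by move=> [x0 [xv xu]]; split => //; apply/cylinder_cons.
have [n] := ubnP (size l + size l')%N; elim: n l l' => // n ih [|e u] v uvn.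
  case: v uvn => [|e v] uvn.
    by rewrite !cylinder0 !preimage_setT setIT probability_setT !expr0 mulr1.
  rewrite cylinder0 preimage_setT setTI.
  (* With nothing prescribed at even places, the constraint on the odd bits of [x] is one on the
     even bits of [ctail x]; invariance under [ctail] brings it back to the case already handled by
     [step]. *)
  rewrite -[X in coin X]/((ctail : cantor -> cantor) @^-1`
     ((ceven : cantor -> cantor) @^-1` cylinder (e :: v))).
  have := step e v [::]; rewrite cylinder0 preimage_setT setIT => step0.
  have me : measurable ((ceven : cantor -> cantor) @^-1` cylinder (e :: v)).
    by have := mI (e :: v) [::]; rewrite cylinder0 preimage_setT setIT.
  rewrite coin_ctail// step0 -cylinder0.
  rewrite ih// -EFinM /= expr0 !mul1r exprS//.
rewrite step ih//; last by rewrite addnC.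
by rewrite -EFinM /= exprS; congr (_%:E); ring.
Qed.

(** The passage from cylinders to measurable sets is made one argument at a time: first the odd
    bits, with a cylinder prescribed on the even ones, then the even bits with [B] fixed. *)
Lemma coin_split (A B : set cantor) : measurable A -> measurable B ->
  coin ((ceven : cantor -> cantor) @^-1` A `&` (codd : cantor -> cantor) @^-1` B) =
  (coin A * coin B)%E.
Proof.
move=> mA mB.
have mo : measurable ((codd : cantor -> cantor) @^-1` B).
  by rewrite -[X in measurable X]setTI; exact: measurable_codd.
have step l B' : measurable B' -> coin ((ceven : cantor -> cantor) @^-1` cylinder l `&`
    (codd : cantor -> cantor) @^-1` B') = ((2^-1 ^+ size l)%:E * coin B')%E.
  move=> mB'.
  apply: (@eq_preimage_pi_system _ _ _ _ _ _ _ measurable_codd _ _ _ cylinders) => //.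
  - rewrite -[X in measurable X]setTI; apply: measurable_ceven => //.
    exact: measurable_cylinder.
  - exact: setI_closed_cylinders.
  - exact: cylindersT.
  - move=> _ [->|[l' ->]]; first by rewrite preimage_set0 setI0 !measure0 mule0.
    by rewrite coin_split_cylinder coin_cylinder.
rewrite setIC muleC -[coin B]fineK ?fin_num_measure//.
apply: (@eq_preimage_pi_system _ _ _ _ _ _ _ measurable_ceven _ mo _ cylinders) => //.
- exact: fine_ge0.
- exact: setI_closed_cylinders.
- exact: cylindersT.
- move=> _ [->|[l ->]]; first by rewrite preimage_set0 setI0 !measure0 mule0.
  by rewrite setIC step// coin_cylinder fineK ?fin_num_measure// muleC.
Qed.

End coin_tossing.

(** * Inverse transform sampling *)

(** Rays are stable under intersection but the whole line is not one of them, so it is exhausted by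
    the rays starting at [-n]. *)
Lemma eq_measure_rays (R : realType) (m1 m2 : {measure set (measurableTypeR R) -> \bar R}) :
  (forall x, m1 `]x, +oo[%classic = m2 `]x, +oo[%classic) -> (m1 setT < +oo)%E ->
  forall A, measurable A -> m1 A = m2 A.
Proof.
move=> h m1oo A mA.
have mG : @measurable _ (measurableTypeR R) = <<s @RGenOInfty.G R >>.
  exact: RGenOInfty.measurableE.
have := @measure_unique _ R (measurableTypeR R) (@RGenOInfty.G R)
  (fun n => `](-n%:R : R), +oo[%classic) mG _ _ _ m1 m2 _ _ A mA.
apply => //.
- move=> _ _ [x ->] [y ->]; exists (Num.max x y).
  by apply/seteqP; split=> z /=; rewrite !in_itv/= !andbT gt_max => /andP.
- by move=> n; exists (- n%:R).
- rewrite -subTset => x _; exists (Num.bound `|x : R|) => //=.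
  rewrite in_itv/= andbT ltrNl; apply: le_lt_trans (ler_norm _) _.
  by rewrite normrN; exact: archi_boundP.
- by move=> _ [x ->].
- by move=> k; apply: le_lt_trans m1oo; rewrite le_measure ?inE.
Qed.

Section inverse_transform.
Context {R : realType}.
Local Notation unif := (uniform_prob (@ltr01 R)).

Let idR : measurableTypeR R -> R := idfun.

#[local] HB.instance Definition _ :=
  @isMeasurableFun.Build _ _ _ _ idR (@measurable_id _ _ setT).

(** [Q] is the generalized inverse of the distribution function [f] of [mu]. By right continuity of
    [f], [x < Q u] holds exactly when [f x < u], so the law of [Q] agrees with [mu] on rays. *)
Lemma inverse_transform_sampling (mu : probability (measurableTypeR R) R) :
  exists Q : R -> R, measurable_fun setT Q /\
    forall A, measurable A -> unif (Q @^-1` A) = mu A.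
Proof.
pose X : {RV mu >-> R} := idR.
pose f r := fine (cdf X r).
have fE r : mu `]-oo, r]%classic = (f r)%:E.
  by rewrite /f fineK// fin_num_measure.
have f0 r : 0 <= f r by exact: fine_ge0.
have f1 r : f r <= 1.
  by rewrite -lee_fin -fE probability_le1.
have fnd x y : x <= y -> f x <= f y.
  by move=> xy; apply: fine_le; rewrite ?fin_num_measure//; exact: cdf_nondecreasing.
have frc x : f @ x^'+ --> f x.
  apply: fine_cvg; rewrite fineK ?fin_num_measure//; exact: cdf_right_continuous.
have fy : f @ +oo%R --> (1 : R) by exact/fine_cvg/cvg_cdfy1.
have fNy : f @ -oo%R --> (0 : R) by exact/fine_cvg/cvg_cdfNy0.
pose S u := [set x | u <= f x].
have hS u : 0 < u < 1 -> has_inf (S u).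
  move=> /andP[u0 u1]; split.
    have [x xu] : exists x, u <= f x.
      have := @cvgr_ge _ _ _ _ _ _ fy _ u1; case=> M [_ h].
      by exists (M + 1); apply: h; rewrite ltrDl.
    by exists x.
  have [y yu] : exists y, f y < u.
    have := @cvgr_lt _ _ _ _ _ _ fNy _ u0; case=> M [_ h].
    by exists (M - 1); apply: h; rewrite gtrBl.
  by exists y => x /= ux; rewrite leNgt; apply/negP => /ltW/fnd; rewrite leNgt (lt_le_trans yu).
(* For [u] outside []0, 1[] the set [S u] can be empty or unbounded below; the default 0 is then
   taken, which within [[0, 1[] concerns only the point 0. *)
pose Q u := if 0 < u < 1 then inf (S u) else 0.
have QE u x : 0 < u < 1 -> (x < Q u) = (f x < u).
  move=> u01; rewrite /Q u01; apply/idP/idP => [xQ|fxu].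
    rewrite ltNge; apply/negP => ux.
    by have := ge_inf (hS _ u01).2 ux; rewrite leNgt xQ.
  rewrite ltNge; apply/negP => Qx; move: fxu; rewrite ltNge => /negP; apply.
  (* Each [y > x] exceeds some element of [S u], hence [u <= f y]; letting [y] decrease to [x] gives
     [u <= f x]. *)
  apply: (cvgr_to_ge (frc x)); near=> y.
  have xy : 0 < y - x by rewrite subr_gt0.
  have [z Sz zy] := inf_adherent xy (hS _ u01).
  apply: (le_trans Sz); apply: fnd; apply: ltW; apply: (lt_le_trans zy).
  by rewrite -lerBrDr opprB addrCA subrr addr0.
have mQ : measurable_fun setT Q.
  apply: (measurability _ (RGenOInfty.measurableE R)) => // _ [_ [x ->] <-].
  rewrite setTI (_ : _ @^-1` _ = (`]0, 1[ `&` `]f x, +oo[) `|`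
     (~` `]0, 1[ `&` [set u | x < 0])); last first.
    apply/seteqP; split=> u /=; rewrite !in_itv/= !andbT.
      have [u01|u01] := boolP (0 < u < 1); first by rewrite QE//; left.
      by rewrite {1}/Q (negbTE u01) => x0; right.
    move=> [[u01 fxu]|[/negP/negbTE u01 x0]]; first by rewrite QE.
    by rewrite /Q u01.
  apply: measurableU; first exact: measurableI.
  apply: measurableI; first exact: measurableC.
  have [x0|x0] := boolP (x < 0).
    by rewrite (_ : [set u | _] = setT)//; apply/seteqP; split.
  by rewrite (_ : [set u | _] = set0)//; apply/seteqP; split.
exists Q; split=> // A mA.
pose m1 : {measure set (measurableTypeR R) -> \bar R} :=
  pushforward unif (Q : measurableTypeR R -> measurableTypeR R).
rewrite -[LHS]/(m1 mQ A).
apply: eq_measure_rays => // [x|]; last first.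
  by rewrite /m1/= /pushforward/= preimage_setT (probability_setT unif) ltry.
rewrite /m1/= /pushforward.
  have mx : measurable (Q @^-1` `]x, +oo[) by rewrite -[X in measurable X]setTI; exact: mQ.
  rewrite uniform_prob01E//.
  have -> : mu `]x, +oo[%classic = (1 - f x)%:E.
    by rewrite -setCitvl probability_setC//= fE.
  have <- : lebesgue_measure (`]f x, 1[ : set R) = (1 - f x)%:E.
    rewrite lebesgue_measure_itv/= lte_fin -EFinB; case: ltP => // h.
    by congr (_%:E); apply/esym/eqP; rewrite subr_eq0 eq_le h f1.
  apply/eqP; rewrite eq_le; apply/andP; split; last first.
    rewrite le_measure ?inE//; first exact: measurableI.
    move=> u /=; rewrite !in_itv/= andbT => /andP[fu u1].
    have u0 : 0 < u by exact: le_lt_trans fu.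
    by rewrite QE ?u0// fu (ltW u0) u1.
  apply: (@le_trans _ _ (lebesgue_measure (`]f x, 1[ `|` [set 0]))).
    rewrite le_measure ?inE//; first exact: measurableI.
      exact: measurableU.
    move=> u /=; rewrite !in_itv/= andbT => -[+ /andP[u0 u1]].
    have [->|un] := eqVneq u 0; first by right.
    have {}u0 : 0 < u by rewrite lt_neqAle eq_sym un.
    by rewrite QE ?u0// => fu; left; rewrite fu.
  apply: (le_trans (measureU2 _ _ _)) => //=.
  by rewrite lebesgue_measure_set1 adde0.
Unshelve. all: by end_near. Qed.

End inverse_transform.

(** * Existence of i.i.d. sequences *)

(* If [(Y, b)] has law [(law of Y) x P], then [Y], [Y \o b], [Y \o b \o b], ...
   is an i.i.d. sequence. *)
Section splitting.
Context d (T : measurableType d) (R : realType) (P : probability T R).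
Variables (Y : T -> R) (b : T -> T).
Hypotheses (mY : measurable_fun setT Y) (mb : measurable_fun setT b).
Hypothesis split : forall A B, measurable A -> measurable B ->
  P (Y @^-1` A `&` b @^-1` B) = (P (Y @^-1` A) * P B)%E.

Let X i := Y \o iter i b.

Lemma measurable_splitting i : measurable_fun setT (X i).
Proof.
apply: measurableT_comp => //.
by elim: i => [|i ih]; [exact: measurable_id|exact: (measurableT_comp mb ih)].
Qed.

Let mX i A : measurable A -> measurable (X i @^-1` A).
Proof. by move=> mA; rewrite -[X in measurable X]setTI; exact: measurable_splitting. Qed.

Lemma splitting_marginal i A : measurable A -> P (X i @^-1` A) = P (Y @^-1` A).
Proof.
move=> mA; elim: i => // i <-.
rewrite (_ : X i.+1 @^-1` A = Y @^-1` setT `&` b @^-1` (X i @^-1` A)).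
  by rewrite split//= ?preimage_setT ?probability_setT ?mul1e//; exact: mX.
by rewrite preimage_setT setTI; apply/seteqP; split=> w; rewrite /X /= -iterSr.
Qed.

(** The conditions on [X 1, ..., X n] are the preimage under [b] of the shifted conditions on
    [X 0, ..., X n.-1], so [split] peels off the first factor. *)
Let bigcap_prod n (B : nat -> set R) : (forall i, measurable (B i)) ->
  P (\bigcap_(i < n) (X i @^-1` B i)) = (\prod_(i < n) P (Y @^-1` B i))%E.
Proof.
elim: n B => [|n ih] B mB.
  by rewrite bigcap_mkord !big_ord0 probability_setT.
rewrite big_ord_recl /= -(ih (fun i => B i.+1))// -split//; last first.
  by apply: bigcap_measurableType => i _; exact: mX.
congr (P _); apply/seteqP; split=> w /=.
  move=> h; split; first exact: (h 0%N).
  by move=> i /= ni; have := h i.+1; rewrite /X /= -iterSr; exact.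
by move=> [w0 h] [|i] //= ni; have := h i; rewrite /X /= -iterSr; exact.
Qed.

(** A finite index set is completed to an initial segment, the added indices carrying the trivial
    condition [setT]. *)
Lemma splitting_iid : iid P X.
Proof.
split; last by move=> n A mA; rewrite !splitting_marginal.
move=> I B uI mB.
pose n := (\max_(i <- I) i).+1.
have In i : i \in I -> (i < n)%N by move=> iI; rewrite ltnS; exact: leq_bigmax_seq.
pose B' i := if i \in I then B i else setT.
have mB' i : measurable (B' i) by rewrite /B'; case: ifP.
rewrite (_ : \bigcap_(i in _) _ = \bigcap_(i < n) (X i @^-1` B' i)); last first.
  apply/seteqP; split=> w /= h i /=; rewrite /B'.
    by move=> ni; case: ifPn => // iI; exact: h.
  by move=> iI; have := h i (In _ iI); rewrite /B' iI.
rewrite bigcap_prod// -(big_mkord xpredT (fun i => P (Y @^-1` B' i))).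
rewrite (eq_bigr (fun i => if i \in I then P (Y @^-1` B i) else 1%E)); last first.
  by move=> i _; rewrite /B'; case: ifP => //; rewrite preimage_setT probability_setT.
rewrite -big_mkcond/= -big_filter.
rewrite (perm_big I); first by apply: eq_bigr => i _; rewrite splitting_marginal.
apply: uniq_perm => // [|i]; first exact/filter_uniq/iota_uniq.
rewrite mem_filter mem_index_iota /=.
by apply/andP/idP => [[]//|iI]; split => //; exact: In.
Qed.

End splitting.

(** Under [coin], [bin_value] is uniform because it inverts [digits] on [[0, 1)]; composed with the
    quantile function [Q] it has law [mu]. Reading it on the even bits leaves the odd bits as the
    independent copy of the whole space. *)
Theorem exists_iid_sequence (R : realType) (mu : probability (measurableTypeR R) R) :
  exists (d : measure_display) (T : measurableType d) (P : probability T R)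
    (X : nat -> {RV P >-> R}), iid P (fun i => X i : T -> R) /\
    forall A, measurable A -> P (X 0%N @^-1` A) = mu A.
Proof.
have [Q [mQ QE]] := inverse_transform_sampling mu.
pose g : cantor -> R := Q \o bin_value.
have mg : measurable_fun setT g by apply: measurableT_comp => //; exact: measurable_bin_value.
pose Y : cantor -> R := g \o ceven.
have mY : measurable_fun setT Y by apply: measurableT_comp => //; exact: measurable_ceven.
have mb := measurable_codd.
have mgA A : measurable A -> measurable (g @^-1` A).
  by move=> mA; rewrite -[X in measurable X]setTI; exact: mg.
have YE A : measurable A -> coin (Y @^-1` A) = coin (g @^-1` A) :> \bar R.
  move=> mA; have := @coin_split R _ _ (mgA _ mA) measurableT.
  by rewrite preimage_setT setIT probability_setT mule1.
have sp A B : measurable A -> measurable B ->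
    (coin (Y @^-1` A `&` (codd : cantor -> cantor) @^-1` B) =
     coin (Y @^-1` A) * coin B :> \bar R)%E.
  by move=> mA mB; rewrite YE// -coin_split//; exact: mgA.
pose X i := Y \o iter i (codd : cantor -> cantor).
have mX i : measurable_fun setT (X i) by exact: measurable_splitting.
pose X' i : {RV (@coin R) >-> R} := HB.pack (X i) (isMeasurableFun.Build _ _ _ _ (X i) (mX i)).
exists (sigma_display cylinders), cantor, (@coin R), X'; split.
  exact: (splitting_iid mY mb sp).
move=> A mA; rewrite [LHS]YE// -QE// coinE.
have mQA : measurable (Q @^-1` A) by rewrite -[X in measurable X]setTI; exact: mQ.
rewrite !uniform_prob01E//; last first.
  rewrite -[X in measurable X]setTI; apply: measurable_digits => //; exact: mgA.
congr (lebesgue_measure _); apply/seteqP; split=> x /= [+ x01];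
  by rewrite /g /= bin_value_digits//; move: x01; rewrite in_itv.
Qed.

Lemma measurable_set_ler d (T : measurableType d) (R : realType) (f g : T -> R) :
  measurable_fun setT f -> measurable_fun setT g -> measurable [set x | f x <= g x].
Proof. by move=> mf mg; rewrite -[X in measurable X]setTI; exact: measurable_fun_le. Qed.

Lemma measurable_set_ltr d (T : measurableType d) (R : realType) (f g : T -> R) :
  measurable_fun setT f -> measurable_fun setT g -> measurable [set x | f x < g x].
Proof.
move=> mf mg; rewrite (_ : [set x | _] = ~` [set x | g x <= f x]).
  exact/measurableC/measurable_set_ler.
by apply/seteqP; split=> x /=; rewrite ltNge => /negP.
Qed.

(** * Relative entropy bounds *)

Section entropy.
Context {R : realType}.
Local Notation mu := (@lebesgue_measure R).

(** This is [1 + u <= exp u] at [u = h - ln (y / z)], multiplied by [y]. Equality holds at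
    [h = ln (y / z)]: it is the pointwise form of the duality between entropy and the
    exponential. *)
Lemma xlnx_young (y z h : R) : 0 <= y -> 0 < z ->
  y * h + y - z * expR h <= y * ln (y / z).
Proof.
rewrite le_eqVlt => /predU1P[<-|y0] z0.
  by rewrite !mul0r !add0r oppr_le0 mulr_ge0// ?expR_ge0// ltW.
have yz : 0 < y / z by rewrite divr_gt0.
have : 1 + (h - ln (y / z)) <= expR (h - ln (y / z)) by exact: expR_ge1Dx.
rewrite expRD expRN lnK ?posrE// invf_div.
rewrite -(ler_pM2l y0) => H.
have e : y * (expR h * (z / y)) = z * expR h by field; rewrite gt_eqF.
move: H; rewrite e mulrDr mulr1 mulrBr -subr_ge0 => H.
by rewrite -subr_ge0; apply: le_trans H _; rewrite le_eqVlt; apply/orP; left; apply/eqP; ring.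
Qed.

(** The entropy integrand may have an infinite integral, so positive and negative parts are compared
    separately. *)
Lemma le_integral_posneg d (T : measurableType d) (m : {measure set T -> \bar R})
    (D : set T) (f g : T -> \bar R) :
  measurable D -> measurable_fun D f -> measurable_fun D g ->
  (forall x, D x -> (f x <= g x)%E) ->
  (\int[m]_(x in D) f x <= \int[m]_(x in D) g x)%E.
Proof.
move=> mD mf mg fg; rewrite [leLHS]integralE [leRHS]integralE; apply: leeB.
  apply: ge0_le_integral => //; try exact: measurable_funepos.
  by move=> x Dx; rewrite !funeposE ge_max !le_max fg//= lexx orbT.
apply: ge0_le_integral => //; try exact: measurable_funeneg.
by move=> x Dx; rewrite !funenegE ge_max !le_max leeN2 fg//= lexx orbT.
Qed.

Lemma normal_pdf01E (x : R) : normal_pdf 0 1 x = normal_peak 1 * expR (- x ^+ 2 / 2).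
Proof.
by rewrite normal_pdfE ?oner_neq0// /normal_fun subr0 expr1n.
Qed.

Lemma measurable_rel_entropy (p : R -> R) : measurable_fun setT p ->
  measurable_fun setT (fun x => (p x * ln (p x / normal_pdf 0 1 x))%:E).
Proof.
move=> mp; apply/measurable_EFinP; apply: measurable_funM => //.
apply: (measurableT_comp (@measurable_ln R)); apply: measurable_funM => //.
rewrite (_ : (fun x => _) = (fun x : R => (normal_peak 1)^-1 * expR (x ^+ 2 / 2))).
  apply: measurable_funM => //; apply: (measurableT_comp (@measurable_expR R)).
  exact: measurable_funM.
by apply/funext => x; rewrite normal_pdf01E invfM -expRN mulNr opprK.
Qed.

(** Boundedness controls [ln p] from above and minus the logarithm of the normal density is
    quadratic, so the integrand is at most [C p + x^2 p / 2]. The absolute value in [C] makes this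
    majorant nonnegative. *)
Lemma rel_entropy_normal_lty (p : R -> R) (M : R) :
  measurable_fun setT p -> (forall x, 0 <= p x <= M) ->
  (\int[mu]_x (p x)%:E < +oo)%E -> (\int[mu]_x (x ^+ 2 * p x)%:E < +oo)%E ->
  (rel_entropy_normal p 0 1 < +oo)%E.
Proof.
move=> mp pM p1 p2; pose C := `|ln M - ln (normal_peak (1 : R))|.
have C0 : 0 <= C by exact: normr_ge0.
have p0 x : 0 <= p x by have /andP[] := pM x.
have pk : 0 < normal_peak 1 :> R by rewrite normal_peak_gt0// oner_neq0.
have m2 : measurable_fun setT (fun x : R => (x ^+ 2 * p x)%:E).
  by apply/measurable_EFinP; apply: measurable_funM => //; exact: exprn_measurable.
have mp' : measurable_fun setT (fun x : R => (p x)%:E) by exact/measurable_EFinP.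
apply: (@le_lt_trans _ _ (\int[mu]_x (C%:E * (p x)%:E + 2^-1%:E * (x ^+ 2 * p x)%:E))%E).
  apply: le_integral_posneg => //.
  - exact: measurable_rel_entropy.
  - by apply: emeasurable_funD; exact: emeasurable_funM.
  - move=> x _; rewrite -!EFinM -EFinD lee_fin.
    have := p0 x; rewrite le_eqVlt => /predU1P[<-|px]; first by rewrite !mul0r !mulr0 addr0.
    rewrite normal_pdf01E ln_div ?posrE ?mulr_gt0 ?expR_gt0//.
    rewrite lnM ?posrE ?expR_gt0// expRK.
    have pxM : p x <= M by have /andP[] := pM x.
    have lM : ln (p x) <= ln M by rewrite ler_ln ?posrE// (lt_le_trans px).
    have : ln (p x) - (ln (normal_peak 1) + - x ^+ 2 / 2) <= C + x ^+ 2 / 2.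
      have := ler_norm (ln M - ln (normal_peak (1 : R))); rewrite -/C; lra.
    by move=> /(ler_wpM2l (ltW px)); congr (is_true (_ <= _)); field.
rewrite ge0_integralD//; last 4 first.
- by move=> x _; rewrite -EFinM lee_fin mulr_ge0.
- exact: emeasurable_funM.
- move=> x _; rewrite -EFinM lee_fin; apply: mulr_ge0 => //.
  by apply: mulr_ge0 => //; exact: sqr_ge0.
- exact: emeasurable_funM.
rewrite ge0_integralZl//; last by move=> x _; rewrite lee_fin.
rewrite ge0_integralZl//; last first.
  by move=> x _; rewrite lee_fin; apply: mulr_ge0 => //; exact: sqr_ge0.
by rewrite lte_add_pinfty// lte_mul_pinfty// lee_fin.
Qed.

(** Half of the exponent [x^2 / 2] is kept for the normal density of variance 2, and the other half
    is at least [r^2 / 4]; [sqrt 2] is the ratio of the two peaks. *)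
Lemma normal_tail_tilt (L r x : R) : r ^+ 2 <= x ^+ 2 ->
  normal_pdf 0 1 x * expR L <=
  (Num.sqrt 2 * expR (L - r ^+ 2 / 4)) * normal_pdf 0 (Num.sqrt 2) x.
Proof.
move=> rx.
have s20 : Num.sqrt (2 : R) != 0 by rewrite gt_eqF// sqrtr_gt0.
rewrite normal_pdf01E normal_pdfE// /normal_fun subr0 sqr_sqrtr//.
have -> : normal_peak (1 : R) = Num.sqrt 2 * normal_peak (Num.sqrt 2).
  rewrite /normal_peak sqr_sqrtr// expr1n mul1r -[in RHS]mulrnAr.
  by rewrite sqrtrM// invfM mulrA divff// mul1r.
have h : expR (- x ^+ 2 / 2) * expR L <=
    expR (L - r ^+ 2 / 4) * expR (- x ^+ 2 / (2 *+ 2)).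
  by rewrite -!expRD ler_expR -mulr_natr; lra.
have ab : 0 <= Num.sqrt 2 * normal_peak (Num.sqrt (2 : R)).
  by rewrite mulr_ge0// normal_peak_ge0.
by move: (ler_wpM2l ab h); congr (is_true (_ <= _)); ring.
Qed.

(* The Young inequality above with [h] equal to [L] on the tail event and [0]
   elsewhere; the exponentially tilted normal tail is dominated by a normal
   density of variance 2. *)
Lemma rel_entropy_normal_tail_bound (p : R -> R) (L r : R) :
  measurable_fun setT p -> (forall x, 0 <= p x) ->
  (\int[mu]_x (p x)%:E = 1)%E -> 0 <= r ->
  (L%:E * \int[mu]_(x in [set x | r < `|x|]%R) (p x)%:E
     - (Num.sqrt 2 * expR (L - r ^+ 2 / 4))%:E <= rel_entropy_normal p 0 1)%E.
Proof.
move=> mp p0 p1 r0; set A := [set x | r < `|x|].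
have mA : measurable A.
  by apply: measurable_set_ltr => //; exact: normr_measurable.
set K := Num.sqrt 2 * _.
have K0 : 0 <= K by rewrite mulr_ge0// expR_ge0.
have ip : mu.-integrable setT (EFin \o p).
  apply/integrableP; split; first exact/measurable_EFinP.
  by under eq_integral do rewrite /= ger0_norm//; rewrite p1 ltry.
have ipA : mu.-integrable setT ((EFin \o p) \_ A).
  by apply/integrable_restrict => //=; rewrite setTI; exact: integrableS ip.
pose f1 := (fun x => L%:E * ((EFin \o p) \_ A) x)%E.
have if1 : mu.-integrable setT f1 by exact: integrableZl.
pose f2 := (fun x => f1 x + (p x)%:E)%E.
have if2 : mu.-integrable setT f2 by exact: integrableD.
pose f3 := (fun x => K%:E * (normal_pdf 0 (Num.sqrt 2) x)%:E)%E.
have if3 : mu.-integrable setT f3 by apply: integrableZl => //; exact: integrable_normal_pdf.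
pose f4 := (fun x => (normal_pdf 0 1 x)%:E + f3 x)%E.
have if4 : mu.-integrable setT f4 by apply: integrableD => //; exact: integrable_normal_pdf.
have e1 : (\int[mu]_x f1 x = L%:E * \int[mu]_(x in A) (p x)%:E)%E.
  by rewrite integralZl// -integral_mkcond.
have e2 : (\int[mu]_x f2 x = L%:E * \int[mu]_(x in A) (p x)%:E + 1)%E.
  by rewrite integralD// e1 -p1.
have e4 : (\int[mu]_x f4 x = 1 + K%:E)%E.
  rewrite integralD//; last exact: integrable_normal_pdf.
  rewrite integral_normal_pdf integralZl//; last exact: integrable_normal_pdf.
  by rewrite integral_normal_pdf mule1.
(* The unit masses of [p] in [f2] and of the standard normal density in [f4] cancel. *)
have -> : (L%:E * \int[mu]_(x in A) (p x)%:E - K%:E = \int[mu]_x (f2 x - f4 x))%E.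
  rewrite integralB// e2 e4.
  have : (\int[mu]_(x in A) (p x)%:E)%E \is a fin_num.
    by apply: integrable_fin_num => //; exact: integrableS ip.
  move=> /fineK <-; rewrite -!EFinM -!EFinD; congr (_%:E); ring.
apply: le_integral_posneg => //.
- by apply: emeasurable_funB; [exact: measurable_int if2|exact: measurable_int if4].
- exact: measurable_rel_entropy.
- move=> x _; rewrite /f2 /f4 /f1 /f3 patchE.
  have phi0 : 0 < normal_pdf 0 1 x :> R.
    by rewrite normal_pdf01E mulr_gt0 ?expR_gt0// normal_peak_gt0// oner_neq0.
  case: ifPn => /= xA; rewrite ?mule0 ?add0e -?EFinM -!EFinD lee_fin.
    have := xlnx_young L (p0 x) phi0; apply: le_trans.
    have rx : r ^+ 2 <= x ^+ 2.
      move: xA; rewrite inE /A /= => /ltW xr.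
      by rewrite -[leRHS](real_normK (num_real x)) ler_sqr ?nnegrE.
    have := normal_tail_tilt L rx; rewrite -/K.
    by have := ltW phi0; lra.
  have := xlnx_young 0 (p0 x) phi0; apply: le_trans.
  rewrite mulr0 add0r expR0 mulr1 opprD addrA gerBl mulr_ge0//.
  exact: normal_pdf_ge0.
Qed.

End entropy.

(** * Sums of i.i.d. variables *)

Section independence.
Context d (T : measurableType d) (R : realType) (P : probability T R).
Variable X : nat -> {RV P >-> R}.
Hypothesis indX : mutually_independent P (fun i => X i : T -> R).
Local Open Scope ereal_scope.

Let mX i A : measurable A -> measurable (X i @^-1` A).
Proof. by move=> mA; exact: measurable_funPTI. Qed.

(** A pi-system generating the sigma-algebra of the [X j] with [j] in [J]. *)
Definition joint_events (J : seq nat) : set (set T) :=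
  [set C | exists B : nat -> set R, (forall j, measurable (B j)) /\
     C = \bigcap_(j in [set` J]) (X j @^-1` B j)].

Lemma measurable_joint_events J : joint_events J `<=` measurable.
Proof.
move=> _ [B [mB ->]]; apply: bigcap_measurableType => j _; exact: mX.
Qed.

Lemma measurable_joint_eventsP J j : j \in J ->
  measurable_fun [set: g_sigma_algebraType (joint_events J)] (X j : T -> R).
Proof.
move=> jJ _ A mA; rewrite setTI; apply: sub_sigma_algebra.
exists (fun k => if k == j then A else setT); split; first by move=> k; case: ifP.
apply/seteqP; split=> w /= h; first by move=> k kJ /=; case: eqP => // ->.
by have := h j jJ; rewrite /= eqxx.
Qed.

(** Mutual independence speaks of intersections of conditions on single variables, while the sign of
    a sum is not of this form; the product rule is therefore extended to the generated
    sigma-algebra. *)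
Lemma independent_joint_events i J A C : uniq (i :: J) -> measurable A ->
  <<s joint_events J >> C ->
  P (X i @^-1` A `&` C) = P (X i @^-1` A) * P C.
Proof.
move=> uiJ mA; move: C.
have mXA := mX i mA.
have k0 : (0 <= fine (P (X i @^-1` A)))%R by exact: fine_ge0.
pose m1 : {measure set T -> \bar R} := mrestr P mXA.
pose m2 : {measure set T -> \bar R} := mscale (NngNum k0) P.
have m12 C : <<s joint_events J >> C -> m1 C = m2 C.
  have jT : joint_events J setT.
    exists (fun=> setT); split=> //; exact/esym/seteqP.
  apply: (@g_sigma_algebra_measure_unique _ _ _ (joint_events J)
    (@measurable_joint_events J) (fun=> setT)) => //.
  - by rewrite bigcup_const//; exists 0%N.
  - move=> _ _ [B [mB ->]] [B' [mB' ->]].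
    exists (fun j => B j `&` B' j); split=> [j|]; first exact: measurableI.
    apply/seteqP; split=> w /=.
      by move=> [h h'] j jJ; split; [exact: h|exact: h'].
    by move=> h; split=> j jJ; have [] := h j jJ.
  - move=> _ [B [mB ->]]; rewrite /m1 /m2 /= /mrestr /mscale /= fineK ?fin_num_measure//.
    pose B' k := if k == i then A else B k.
    have mB' k : measurable (B' k) by rewrite /B'; case: ifP.
    have iJ : i \notin J by move: uiJ => /andP[].
    have jB j : j \in J -> B' j = B j.
      by move=> jJ; rewrite /B'; case: eqP => // ji; rewrite -ji jJ in iJ.
    transitivity (P (\bigcap_(j in [set` i :: J]) (X j @^-1` B' j))).
      congr (P _); apply/seteqP; split=> w /=.
        move=> [h wA] j /=; rewrite inE => /predU1P[->|jJ].
          by rewrite /B' eqxx.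
        by rewrite jB//; exact: h.
      move=> h; split.
        by move=> j jJ /=; rewrite -jB//; apply: h; rewrite /= inE jJ orbT.
      by have := h i; rewrite /B' eqxx; apply; rewrite /= inE eqxx.
    rewrite indX// big_cons {1}/B' eqxx; congr (_ * _).
    rewrite (eq_big_seq (fun j => P (X j @^-1` B j))); last by move=> j /jB ->.
    by rewrite -indX//; move: uiJ => /andP[].
  - by move=> _; rewrite /m1/= /mrestr setTI -ge0_fin_numE// fin_num_measure.
move=> C /m12; rewrite /m1 /m2 /= /mrestr /mscale /= fineK ?fin_num_measure//.
by rewrite setIC.
Qed.

End independence.

(** * Sums dominated by one large term *)

Section big_jump.
Context d (T : measurableType d) (R : realType) (P : probability T R).
Variable X : nat -> {RV P >-> R}.
Hypothesis iidX : iid P (fun i => X i : T -> R).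
Local Open Scope ereal_scope.

Let rest n i := [seq j <- iota 0 n | j != i].

(* The events "only [X i] exceeds [t] in absolute value, and the sum of the others
   has weakly the sign of [X i]" are disjoint, and each of them forces the sum
   to exceed [t]. *)
Lemma big_jump (n : nat) (t q : R) : (0 <= t)%R ->
  P [set w | (t < X 0%N w)%R] = q%:E -> P [set w | (X 0%N w < - t)%R] = q%:E ->
  (n%:R * (2 * q) <= 2^-1)%R ->
  (n%:R * q / 2)%:E <= P [set w | (t < `|\sum_(i < n) X i w|)%R].
Proof.
move=> t0 qp qm nq; have [indX idX] := iidX.
have mX i : measurable_fun setT (X i) by exact: measurable_funP.
have q0 : (0 <= q)%R by rewrite -lee_fin -qp.
have Pp i : P (X i @^-1` `]t, +oo[%classic) = q%:E.
  rewrite (idX i)// -qp; congr (P _).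
  by apply/seteqP; split=> w /=; rewrite in_itv/= andbT.
have Pm i : P (X i @^-1` `]-oo, (- t)%R[%classic) = q%:E.
  by rewrite (idX i)// -qm; congr (P _).
have Pa i : P [set w | (t < `|X i w|)%R] <= (2 * q)%:E.
  rewrite (_ : [set w | _] = X i @^-1` `]t, +oo[%classic `|`
      X i @^-1` `]-oo, (- t)%R[%classic); last first.
    apply/seteqP; split=> w /=; rewrite !in_itv/= andbT ltr_normr ltrNr.
      by move=> /orP.
    by move=> [->|->]//; rewrite orbT.
  apply: le_trans (measureU2 _ _ _) _; try exact: measurable_funPTI.
  by rewrite [X in X + _]Pp [X in _ + X]Pm -EFinD mulr_natl mulr2n.
pose s i w := (\sum_(j <- rest n i) X j w)%R.
pose M i := \bigcap_(j in [set` rest n i]) [set w | (`|X j w| <= t)%R].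
pose Cp i := M i `&` [set w | (0 <= s i w)%R].
pose Cm i := M i `&` [set w | (s i w <= 0)%R].
pose A i := (X i @^-1` `]t, +oo[%classic `&` Cp i) `|`
            (X i @^-1` `]-oo, (- t)%R[%classic `&` Cm i).
have ui i : uniq (i :: rest n i).
  by rewrite /= mem_filter eqxx/= filter_uniq// iota_uniq.
have sM i : <<s joint_events X (rest n i) >> (M i).
  rewrite -[<<s _ >>]/(@measurable _ (g_sigma_algebraType (joint_events X (rest n i)))).
  rewrite /M bigcap_mkcond; apply: bigcap_measurableType => j _.
  case: ifPn => [|_]; last exact: measurableT.
  rewrite inE /= => jr; apply: measurable_set_ler => //.
  by apply: measurableT_comp => //; exact: measurable_joint_eventsP.
have ms i : measurable_fun
    [set: g_sigma_algebraType (joint_events X (rest n i))] (s i).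
  (* The summands outside [rest n i] are replaced by 0, so that every summand is measurable for the
     sub-sigma-algebra. *)
  rewrite (_ : s i = (fun w => \sum_(j <- rest n i)
      (if j \in rest n i then X j w else 0))%R); last first.
    by apply/funext => w; rewrite /s big_seq big_mkcond.
  apply: measurable_sum => j.
  case: (boolP (j \in rest n i)) => jr; last exact: measurable_cst.
  exact: measurable_joint_eventsP.
have sp i : <<s joint_events X (rest n i) >> (Cp i).
  apply: (@measurableI _ (g_sigma_algebraType (joint_events X (rest n i)))).
    exact: sM.
  by apply: measurable_set_ler; [|exact: ms].
have sm i : <<s joint_events X (rest n i) >> (Cm i).
  apply: (@measurableI _ (g_sigma_algebraType (joint_events X (rest n i)))).
    exact: sM.
  by apply: measurable_set_ler; [exact: ms|].
have sub i : <<s joint_events X (rest n i) >> `<=` @measurable _ T.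
  apply: smallest_sub; first exact: sigma_algebra_measurable.
  exact: measurable_joint_events.
have mA i : measurable (A i).
  apply: measurableU; apply: measurableI; try exact: measurable_funPTI.
    exact: (sub i _ (sp i)).
  exact: (sub i _ (sm i)).
(* On [A j] the variable [X j] exceeds [t] in absolute value, which [M i] forbids. *)
have tA : trivIset setT (fun i : 'I_n => A i).
  apply/trivIsetP => i j _ _ ij; rewrite -subset0 => w /= [Ai Aj].
  have big (k : 'I_n) : A k w -> (t < `|X k w|)%R.
    by rewrite /A /= !in_itv/= ltr_normr ltrNr; move=> [[/andP[->]]|[->]]//; rewrite orbT.
  have : M i w by case: Ai => -[_ []].
  move=> /(_ (nat_of_ord j)); rewrite /= mem_filter mem_iota /= ltn_ord andbT.
  rewrite -val_eqE/= eq_sym in ij; rewrite ij => /(_ isT).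
  by rewrite leNgt big.
(* Union bound over the other variables; under the smallness hypothesis on [n q] it leaves at least
   1/2. *)
have MB i : (1 - n%:R * (2 * q))%:E <= P (M i).
  have mM := sub _ _ (sM i).
  rewrite EFinB leeBlDr// -leeBlDl; last by rewrite fin_num_measure.
  rewrite -probability_setC//.
  apply: (@le_trans _ _ (P (\big[setU/set0]_(j < n) [set w | (t < `|X j w|)%R]))).
    rewrite le_measure ?inE//; first exact: measurableC.
      apply: bigsetU_measurable => j _; apply: measurable_set_ltr => //.
      exact: measurableT_comp.
    move=> w; rewrite /M /setC /= => /existsNP[j /not_implyP[+ /negP]].
    rewrite -ltNge /= mem_filter mem_iota /= => /andP[_ jn] tj.
    by rewrite -(bigcup_mkord n (fun j => [set w | (t < `|X j w|)%R])); exists j.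
  apply: (le_trans (@Boole_inequality _ _ _ P
    (fun j => [set w | (t < `|X j w|)%R]) n _)) => [j _|].
    by apply: measurable_set_ltr => //; exact: measurableT_comp.
  apply: (@le_trans _ _ (\sum_(j < n) (2 * q)%:E)); first by apply: lee_sum => j _; exact: Pa.
  by rewrite sumEFin lee_fin sumr_const card_ord -[leLHS]mulr_natl.
(* By independence the probability is [q (P (Cp i) + P (Cm i))]. The two sign events cover [M i],
   overlapping where [s i] vanishes, so the sum is at least [P (M i) >= 1/2]. *)
have PA i : (q / 2)%:E <= P (A i).
  rewrite /A measureU; last 3 first.
  - by apply: measurableI; [exact: measurable_funPTI|exact: (sub i _ (sp i))].
  - by apply: measurableI; [exact: measurable_funPTI|exact: (sub i _ (sm i))].
  - rewrite -subset0 => w /= [[+ _] [+ _]]; rewrite !in_itv/= andbT.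
    by move=> h1 h2; lra.
  have ep : P (X i @^-1` `]t, +oo[%classic `&` Cp i) = q%:E * P (Cp i).
    by rewrite (independent_joint_events indX (ui i))// Pp.
  have em : P (X i @^-1` `]-oo, (- t)%R[%classic `&` Cm i) = q%:E * P (Cm i).
    by rewrite (independent_joint_events indX (ui i))// Pm.
  rewrite [X in (_ <= X + _)%E]ep [X in (_ <= _ + X)%E]em.
  rewrite -ge0_muleDr//.
  rewrite EFinM lee_pmul ?lee_fin ?invr_ge0//.
  apply: (@le_trans _ _ (P (M i))).
    by apply: le_trans (MB i); rewrite lee_fin; lra.
  apply: le_trans (measureU2 _ _ _); [|exact: (sub i _ (sp i))|exact: (sub i _ (sm i))].
  rewrite le_measure ?inE; [by []|exact: (sub i _ (sM i))| |].
    by apply: measurableU; [exact: (sub i _ (sp i))|exact: (sub i _ (sm i))].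
  move=> w Mw; have [h|/ltW h] := leP 0%R (s i w); first by left.
  by right.
apply: (@le_trans _ _ (P (\big[setU/set0]_(i < n) A i))).
  rewrite measure_bigsetU_ord//.
  apply: (@le_trans _ _ (\sum_(i < n) (q / 2)%:E)); last by apply: lee_sum => i _; exact: PA.
  by rewrite sumEFin lee_fin sumr_const card_ord -[leRHS]mulr_natl mulrA.
rewrite le_measure ?inE//.
- exact: bigsetU_measurable.
- apply: measurable_set_ltr => //; apply: measurableT_comp => //.
  exact: measurable_sum.
rewrite -(bigcup_mkord n (fun i => A i)) => w [i /= ni].
have -> : (\sum_(j < n) X j w = X i w + s i w)%R.
  rewrite -(big_mkord xpredT (fun j => X j w)) /s /rest big_filter.
  by rewrite /index_iota subn0 (bigD1_seq i)//= ?iota_uniq// mem_iota.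
rewrite /A /Cp /Cm /= !in_itv/= andbT ltr_normr => -[[h [_ h']]|[h [_ h']]].
  by apply/orP; left; lra.
by apply/orP; right; lra.
Qed.

End big_jump.

(** * Mean and variance of the normalized sum *)

Section sum_variance.
Context d (T : measurableType d) (R : realType) (P : probability T R).
Variable X : nat -> {RV P >-> R}.
Hypothesis iidX : iid P (fun i => X i : T -> R).
Hypothesis EX0 : ('E_P[X 0%N] = 0)%E.
Hypothesis EX2 : ('E_P[fun w => (X 0%N w ^+ 2)%R] = 1)%E.

Lemma iid_ge0_expectation (g : R -> R) i : measurable_fun setT g ->
  (forall x, 0 <= g x) -> ('E_P[g \o X i] = 'E_P[g \o X 0%N])%E.
Proof.
move=> mg g0; rewrite unlock.
have e j : (\int[P]_w (g (X j w))%:E = \int[distribution P (X j)]_x (g x)%:E)%E.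
  rewrite (@ge0_integral_distribution _ _ _ _ _ P (X j) (EFin \o g))//.
  exact/measurable_EFinP.
apply: (etrans (e i)); apply: (etrans _ (esym (e 0%N))).
apply: eq_measure_integral => A mA _.
exact: (iidX.2 i).
Qed.

Lemma iid_Lfun2 i : (X i : T -> R) \in Lfun P 2%:E.
Proof.
have e : ('E_P[fun w => (X i w ^+ 2)%R] = 1)%E.
  rewrite -EX2; apply: (@iid_ge0_expectation (fun x => x ^+ 2)).
    exact: exprn_measurable.
  by move=> x; exact: sqr_ge0.
rewrite inE/=; apply/andP; split; rewrite inE/=; first exact: measurable_funP.
rewrite /finite_norm unlock /Lnorm; apply: poweR_lty.
rewrite (eq_integral (fun w => ((X i w) ^+ 2)%:E)); last first.
  move=> w _; rewrite /= powR_mulrn//.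
  by rewrite real_normK ?num_real.
by move: e; rewrite unlock => ->; rewrite ltry.
Qed.

Lemma iid_expectation i : ('E_P[X i] = 0)%E.
Proof.
have mgen j : P.-integrable setT (EFin \o X j).
  by apply/Lfun1_integrable; apply: Lfun_subset12 (iid_Lfun2 j); rewrite fin_num_measure.
rewrite -EX0 unlock.
have e j : (\int[P]_w (X j w)%:E = \int[distribution P (X j)]_x x%:E)%E.
  by rewrite (@integral_distribution _ _ _ _ _ P (X j) EFin).
apply: (etrans (e i)); apply: (etrans _ (esym (e 0%N))).
apply: eq_measure_integral => A mA _.
exact: (iidX.2 i).
Qed.

(** Independence identifies the law of the pair with the product law on rectangles; by Fubini the
    expectation of the product has inner integral equal to the mean, which is zero. *)
Lemma iid_covariance i j : i != j -> covariance P (X i) (X j) = 0%E.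
Proof.
move=> ij; have [indX _] := iidX.
have Pfin : P setT \is a fin_num := fin_num_measure P _ measurableT.
have L2 := iid_Lfun2; have L1 k := Lfun_subset12 Pfin (L2 k).
have L12 := Lfun2_mul_Lfun1 (L2 i) (L2 j).
rewrite covarianceE// !iid_expectation mule0 sube0.
pose mu1 : probability _ R := distribution P (X i).
pose mu2 : probability _ R := distribution P (X j).
pose Z w := (X i w, X j w).
have mZ : measurable_fun setT Z by exact/measurable_fun_pair.
pose m : {measure set (R * R) -> \bar R} := pushforward P Z.
have mE A : measurable A -> (mu1 \x mu2)%E A = m mZ A.
  apply: product_measure_unique => B C mB mC.
  rewrite /m/= /pushforward.
  have := indX [:: i; j] (fun k => if k == i then B else C).
  rewrite !big_cons big_nil mule1 eqxx eq_sym (negbTE ij) => <-.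
  - congr (P _); apply/seteqP; split=> w /=.
      move=> [wB wC] k /=; rewrite !inE => /orP[/eqP->|/eqP->].
        by rewrite eqxx.
      by rewrite eq_sym (negbTE ij).
    move=> h; split; have := h i; have := h j.
      by rewrite /= !inE !eqxx /= => _; apply.
    by rewrite /= !inE !eqxx /= orbT eq_sym (negbTE ij) => h' _; apply: h'.
  - by rewrite /= inE ij.
  - by move=> k; case: ifP.
have mf : measurable_fun setT (fun z : R * R => (z.1 * z.2)%:E).
  by apply/measurable_EFinP; apply: measurable_funM; [exact: measurable_fst|exact: measurable_snd].
have if0 : P.-integrable setT ((fun z : R * R => (z.1 * z.2)%:E) \o Z).
  exact/Lfun1_integrable.
rewrite unlock.
transitivity (\int[(mu1 \x mu2)%E]_z (z.1 * z.2)%:E)%E.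
  rewrite (eq_measure_integral (m mZ)); last by move=> A mA _; exact: mE.
  by rewrite (integral_pushforward mZ mf if0).
have imf : (mu1 \x mu2)%E.-integrable setT (fun z : R * R => (z.1 * z.2)%:E).
  have /integrableP[_ moo] := integrable_pushforward mZ mf if0 measurableT.
  apply/integrableP; split=> //.
  by rewrite (eq_measure_integral (m mZ))// => A mA _; exact: mE.
rewrite -integral12_prod_meas1//.
have i2 : mu2.-integrable setT EFin.
  by apply: integrable_pushforward => //; exact/Lfun1_integrable.
have e2 : (\int[mu2]_y y%:E = 0)%E.
  rewrite (@integral_distribution _ _ _ _ _ P (X j) EFin)//.
    by have := iid_expectation j; rewrite unlock.
  exact/Lfun1_integrable.
under eq_integral.
  move=> x _; rewrite /fubini_F /=; under eq_integral do rewrite EFinM.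
  rewrite integralZl// e2 mule0; over.
by rewrite integral0.
Qed.

Lemma iid_sum_Lfun2 n : (fun w => \sum_(i < n) X i w) \in Lfun P 2%:E.
Proof.
elim: n => [|n ih].
  rewrite (_ : (fun _ => _) = cst 0); first exact: Lfun_cst.
  by apply/funext => w; rewrite big_ord0.
rewrite (_ : (fun _ => _) = (fun w => \sum_(i < n) X i w) + (X n : T -> R)).
  by have XL := iid_Lfun2 n; rewrite rpredD ?lee1n.
by apply/funext => w; rewrite big_ord_recr.
Qed.

Lemma iid_sum_moments n : ('E_P[fun w => (\sum_(i < n) X i w)%R] = 0)%E /\
  ('V_P[fun w => (\sum_(i < n) X i w)%R] = n%:R%:E)%E.
Proof.
have Pfin : P setT \is a fin_num := fin_num_measure P _ measurableT.
have L2 := iid_Lfun2; have L1 k := Lfun_subset12 Pfin (L2 k).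
have LS2 := iid_sum_Lfun2; have LS1 k := Lfun_subset12 Pfin (LS2 k).
have VX i : ('V_P[X i] = 1)%E.
  rewrite varianceE// iid_expectation -[LHS]/(_ - 0 * 0)%E mule0 sube0 -EX2.
  apply: (@iid_ge0_expectation (fun x => x ^+ 2)); first exact: exprn_measurable.
  by move=> x; exact: sqr_ge0.
have cov n' j : (n' <= j)%N -> covariance P (fun w => \sum_(i < n') X i w) (X j) = 0%E.
  elim: n' => [|n' ih] nj.
    rewrite (_ : (fun _ => _) = cst 0); first exact: covariance_cst_l.
    by apply/funext => w; rewrite big_ord0.
  rewrite (_ : (fun _ => _) = ((fun w => \sum_(i < n') X i w) \+ X n')%R); last first.
    by apply/funext => w; rewrite big_ord_recr.
  rewrite covarianceDl// ?Lfun2_mul_Lfun1// ih ?(ltnW nj)// add0e.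
  by rewrite iid_covariance// ltn_eqF.
elim: n => [|n [ihE ihV]].
  rewrite (_ : (fun _ => _) = cst 0); last by apply/funext => w; rewrite big_ord0.
  by rewrite expectation_cst variance_cst.
rewrite (_ : (fun _ => _) = ((fun w => \sum_(i < n) X i w) \+ X n)%R); last first.
  by apply/funext => w; rewrite big_ord_recr.
rewrite expectationD// ihE iid_expectation adde0; split => //.
by rewrite varianceD// ihV VX cov// mule0 adde0 -EFinD natr1.
Qed.

(** [D] compares its argument with the normal law of the same mean and variance; these values make
    that law the standard one for every [n > 0]. *)
Lemma normalized_sum_moments n : (0 < n)%N ->
  ('E_P[normalized_sum (fun i => X i : T -> R) n] = 0)%E /\
  ('V_P[normalized_sum (fun i => X i : T -> R) n] = 1)%E.
Proof.
move=> n0; have Pfin : P setT \is a fin_num := fin_num_measure P _ measurableT.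
have [E0 V1] := iid_sum_moments n.
rewrite (_ : normalized_sum _ n =
    ((Num.sqrt n%:R)^-1 \o* (fun w => \sum_(i < n) X i w))%R)//.
rewrite expectationZl ?(Lfun_subset12 Pfin (iid_sum_Lfun2 n))// E0 mule0.
split => //; rewrite varianceZ ?iid_sum_Lfun2// V1 -EFinM.
by rewrite exprVn sqr_sqrtr// mulVf// pnatr_eq0 -lt0n.
Qed.

End sum_variance.

(** * Measures given by a density *)

Section density.
Context {R : realType}.
Local Notation mu := (@lebesgue_measure R).
Variable p : R -> R.
Hypotheses (mp : measurable_fun setT p) (p0 : forall x, 0 <= p x).
Hypothesis p1 : (\int[mu]_x (p x)%:E = 1)%E.

Lemma density_prob : exists nu : probability (measurableTypeR R) R,
  forall A, measurable A -> nu A = (\int[mu]_(x in A) (p x)%:E)%E.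
Proof.
pose f (A : set (measurableTypeR R)) := (\int[mu]_(x in A) (p x)%:E)%E.
have f0 : f set0 = 0%E by rewrite /f integral_set0.
have f_ge0 A : (0 <= f A)%E by apply: integral_ge0 => x _; rewrite lee_fin.
have fs : semi_sigma_additive f.
  move=> /= F mF tF mUF; rewrite /f; apply: cvg_toP.
    apply: ereal_nondecreasing_is_cvgn => m n mn.
    by apply: lee_sum_nneg_natr => // k _ _; exact: f_ge0.
  rewrite ge0_integral_bigcup//=.
  - by apply: measurable_funTS; exact/measurable_EFinP.
  - by move=> x _; rewrite lee_fin.
pose nu : {measure set (measurableTypeR R) -> \bar R} :=
  HB.pack f (isMeasure.Build _ _ _ f f0 f_ge0 fs).
have nu1 : nu setT = 1%E by [].
pose Pnu : probability (measurableTypeR R) R :=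
  HB.pack f nu (Measure_isProbability.Build _ _ _ nu nu1).
by exists Pnu.
Qed.

(** The change of variables holds for the Radon-Nikodym derivative of [nu], which equals [p] almost
    everywhere because both have the same integral over every measurable set. *)
Lemma ge0_integral_density (nu : probability (measurableTypeR R) R) :
  (forall A, measurable A -> nu A = (\int[mu]_(x in A) (p x)%:E)%E) ->
  forall f : R -> \bar R, measurable_fun setT f -> (forall x, 0 <= f x)%E ->
  (\int[nu]_x f x = \int[mu]_x (f x * (p x)%:E))%E.
Proof.
move=> nuE f mf f0.
have ip : mu.-integrable setT (EFin \o p).
  apply/integrableP; split; first exact/measurable_EFinP.
  by under eq_integral do rewrite /= ger0_norm//; rewrite p1 ltry.
have dom : nu `<< mu.
  apply/null_content_dominatesP => A mA muA; rewrite nuE//.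
  apply: null_set_integral => //; apply: measurable_funTS; exact/measurable_EFinP.
rewrite -(Radon_Nikodym_SigmaFinite.change_of_variables dom)//.
have irn := Radon_Nikodym_SigmaFinite.f_integrable dom.
apply: ge0_ae_eq_integral => //.
- by apply: emeasurable_funM => //; exact: measurable_int irn.
- by apply: emeasurable_funM => //; exact/measurable_EFinP.
- by move=> x _; rewrite mule_ge0//; exact: Radon_Nikodym_SigmaFinite.f_ge0.
- by move=> x _; rewrite mule_ge0// lee_fin.
- apply: ae_eqe_mul2l; apply: integral_ae_eq => //; first exact/measurable_EFinP.
  move=> A _ mA; transitivity (nu A); last exact: nuE.
  exact/esym/Radon_Nikodym_SigmaFinite.f_integral.
Qed.

End density.

(** * A density with a heavy tail *)

Section log_tail_integral.
Context {R : realType}.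
Local Notation mu := (@lebesgue_measure R).
Variable eta : R.
Hypothesis eta1 : 1 < eta.

Let f (x : R) := x^-1 * (ln x) `^ (- eta).
Let F (x : R) := (1 - eta)^-1 * (ln x) `^ (1 - eta).

Let dF (x : R) : 1 < x -> is_derive x 1 F (f x).
Proof.
move=> x1; have x0 : 0 < x by exact: lt_trans x1.
have l0 : 0 < ln x by exact: ln_gt0.
have e0 : 1 - eta != 0 by rewrite lt_eqF// subr_lt0.
have h := is_derive1_comp (is_derive1_powR (1 - eta) l0) (is_derive1_ln x0).
have := @is_deriveZ _ _ _ _ (1 - eta)^-1 _ _ _ h.
move=> h'; apply: is_derive_eq.
by rewrite /GRing.scale/= !mulrA mulVf// mul1r /f mulrC addrAC subrr add0r.
Qed.

Let df (x : R) : 1 < x -> {for x, continuous f}.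
Proof.
move=> x1; have x0 : 0 < x by exact: lt_trans x1.
have l0 : 0 < ln x by exact: ln_gt0.
apply: (@cvgM _ R^o); first by apply: cvgV; [rewrite gt_eqF|exact: cvg_id].
have := is_derive1_comp (is_derive1_powR (- eta) l0) (is_derive1_ln x0).
by move=> [/derivable1_diffP/differentiable_continuous].
Qed.

Let cf : {within `[expR 1, +oo[, continuous f}.
Proof.
have e1 : 1 < expR 1 :> R by rewrite -expR0 ltr_expR.
apply: continuous_in_subspaceT => x; rewrite inE/= in_itv/= andbT => ex.
exact/df/(lt_le_trans e1).
Qed.

Lemma measurable_inv_ln_powR : measurable_fun `[expR 1, +oo[ f.
Proof. exact: subspace_continuous_measurable_fun. Qed.

Lemma inv_ln_powR_ge0 x : expR 1 <= x -> 0 <= f x.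
Proof.
move=> ex; rewrite mulr_ge0// ?powR_ge0// invr_ge0.
by apply: le_trans ex; exact: expR_ge0.
Qed.

(** The antiderivative [F] tends to 0 at infinity because [eta > 1]. Since [ln (exp 1) = 1],
    starting at [exp 1] gives a value without any logarithm. *)
Lemma integral_inv_ln_powR :
  (\int[mu]_(x in `[expR 1, +oo[) (f x)%:E = (eta - 1)^-1%:E)%E.
Proof.
have e1 : 1 < expR 1 :> R by rewrite -expR0 ltr_expR.
have cF : {for expR 1, continuous F}.
  by have [/derivable1_diffP/differentiable_continuous] := dF e1.
rewrite (@ge0_continuous_FTC2y _ f F _ 0).
- rewrite /F expRK powR1 mulr1 -EFinB sub0r; congr (_%:E).
  by rewrite -invrN opprB.
- exact: inv_ln_powR_ge0.
- exact: cf.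
- rewrite -[X in _ --> X](mulr0 (1 - eta)^-1).
  apply: (@cvgM _ R^o); first exact: cvg_cst.
  rewrite (_ : (fun x => _) = (fun x : R => ((ln x) `^ (eta - 1))^-1)); last first.
    by apply/funext => x; rewrite -powRN opprB.
  have e0 : 0 < eta - 1 by rewrite subr_gt0.
  rewrite gtr0_cvgV0; last first.
    near=> x; apply: powR_gt0; apply: ln_gt0.
    by near: x; exact: nbhs_pinfty_gt.
  apply/cvgryPge => A; near=> x.
  have Ax : expR (`|A| `^ (eta - 1)^-1) <= x by near: x; exact: nbhs_pinfty_ge.
  have x0 : 0 < x by apply: lt_le_trans Ax; exact: expR_gt0.
  have lA : `|A| `^ (eta - 1)^-1 <= ln x by rewrite -ler_expR lnK.
  apply: (le_trans (ler_norm A)).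
  rewrite -[leLHS]powRr1// -[X in _ `^ X](mulVf (lt0r_neq0 e0)) powRrM.
  by apply: ge0_ler_powR; rewrite ?nnegrE ?powR_ge0 ?(ltW e0)// (le_trans _ lA)// powR_ge0.
- by move=> x ex; have [] := dF (lt_trans e1 ex).
- exact: cvg_at_right_filter.
- move=> x; rewrite in_itv/= andbT => ex.
  by rewrite derive1E; have [_ ->] := dF (lt_trans e1 ex).
Unshelve. all: by end_near. Qed.

End log_tail_integral.

(** * Integrals of even functions *)

Section even_integral.
Context {R : realType}.
Local Notation mu := (@lebesgue_measure R).

Lemma ge0_integral_oppr (A : set R) (f : R -> \bar R) : measurable A ->
  measurable_fun setT f -> (forall x, 0 <= f x)%E ->
  (\int[mu]_(x in A) f x = \int[mu]_(x in -%R @^-1` A) f (- x)%R)%E.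
Proof.
move=> mA mf f0.
rewrite -(@ge0_integral_pushforward _ _ _ _ _
  (-%R : measurableTypeR R -> measurableTypeR R))//=.
- by apply: eq_measure_integral => //= B mB _; exact/esym/lebesgue_measureN.
- exact: measurable_funS mf.
Qed.

Lemma ge0_integral_even (f : R -> \bar R) : measurable_fun setT f ->
  (forall x, 0 <= f x)%E -> (forall x, f (- x)%R = f x) ->
  (\int[mu]_x f x = 2%:E * \int[mu]_(x in `[0%R, +oo[) f x)%E.
Proof.
move=> mf f0 fe.
have mfA A : measurable_fun A f by exact: measurable_funTS.
rewrite -(setUv `[0, +oo[) ge0_integral_setU//=; last 3 first.
- exact: measurableC.
- exact: mfA.
- exact/disj_setPCl.
rewrite mule_natl mule2n; congr (_ + _)%E.
rewrite setCitvr integral_itv_bndo_bndc// [RHS]ge0_integral_oppr//.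
rewrite opp_preimage_itvbndy oppr0.
by apply: eq_integral => x _; rewrite fe.
Qed.

Lemma integral_sqr_sym (b : R) : 0 < b ->
  (\int[mu]_(x in `[(- b)%R, b]) (x ^+ 2)%:E = (2 * b ^+ 3 / 3)%:E)%E.
Proof.
move=> b0.
have dF (x : R) : is_derive x 1 (fun y : R => 3^-1 * y ^+ 3) (x ^+ 2).
  have h := @is_deriveX R R id 3 x 1 1 (is_derive_id x 1).
  have h' := @is_deriveZ _ _ _ _ (3^-1 : R) _ _ _ h.
  apply: (is_derive_eq h').
  by rewrite /GRing.scale /= mulr1 mulrA mulVf ?mul1r// pnatr_eq0.
apply: (etrans (@continuous_FTC2 R (fun x : R => x ^+ 2)
  (fun x : R => 3^-1 * x ^+ 3) (- b) b _ _ _ _)).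
- lra.
- by apply: continuous_subspaceT => x; exact: exprn_continuous.
- have cF (x : R) : {for x, continuous (fun y : R => 3^-1 * y ^+ 3)}.
    by have [/derivable1_diffP/differentiable_continuous] := dF x.
  split.
  + by move=> x _; have [] := dF x.
  + exact/cvg_at_right_filter/cF.
  + exact/cvg_at_left_filter/cF.
- by move=> x _; rewrite derive1E; have [_ ->] := dF x.
- by rewrite -EFinB; congr (_%:E); field.
Qed.

End even_integral.

Section log_tail.
Context {R : realType}.
Local Notation mu := (@lebesgue_measure R).
Variables (eta s : R).
Hypotheses (eta1 : 1 < eta) (s2 : 2 < s).

(** Multiplied by [|x|^s] this is a multiple of [1 / (|x| (ln |x|)^eta)], of integral
    [1 / (eta - 1)] on each side; the factor [(eta - 1) / 4] makes the total 1/2. The cutoff at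
    [exp 1] ensures [|x| >= 1] and [ln |x| >= 1], hence the bound on the function and the comparison
    of its moments. *)
Definition log_tail (x : R) : R := if expR 1 <= `|x| then
  (eta - 1) / 4 * (`|x| `^ (- (s + 1)) * (ln `|x|) `^ (- eta)) else 0.

Let k0 : 0 < (eta - 1) / 4. Proof. by rewrite divr_gt0// subr_gt0. Qed.

Lemma log_tail_ge0 x : 0 <= log_tail x.
Proof.
rewrite /log_tail; case: ifP => // _; apply: mulr_ge0; first exact: ltW.
by rewrite mulr_ge0 ?powR_ge0.
Qed.

Lemma log_tail_even x : log_tail (- x) = log_tail x.
Proof. by rewrite /log_tail normrN. Qed.

Lemma measurable_log_tail : measurable_fun setT log_tail.
Proof.
have mn : measurable_fun [set: R] (fun x : R => `|x|) by exact: normr_measurable.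
apply: measurable_fun_ifT => //; first exact: measurable_fun_ler.
apply: measurable_funM => //; apply: measurable_funM.
  exact: (measurableT_comp (measurable_powR _)).
apply: (measurableT_comp (measurable_powR _)).
exact: (measurableT_comp (@measurable_ln R)).
Qed.

Lemma log_tail_le x : log_tail x <= (eta - 1) / 4.
Proof.
rewrite /log_tail; case: ifPn => [ex|_]; last exact: ltW.
have e1 : 1 < expR 1 :> R by rewrite -expR0 ltr_expR.
have x1 : 1 <= `|x| by apply: le_trans ex; exact: ltW.
have l1 : 1 <= ln `|x| by rewrite -[leLHS]expRK ler_ln ?posrE ?expR_gt0// (lt_le_trans ltr01).
have s1 : - (s + 1) <= 0 :> R by move: s2; lra.
have h1 : - eta <= 0 :> R by move: eta1; lra.
rewrite ler_piMr ?(ltW k0)// mulr_ile1 ?powR_ge0//.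
  by rewrite -[leRHS](powRr0 `|x|); exact: ler_powR.
by rewrite -[leRHS](powRr0 (ln `|x|)); exact: ler_powR.
Qed.

Lemma integral_log_tail_powR :
  (\int[mu]_x (`|x| `^ s * log_tail x)%:E = 2^-1%:E)%E.
Proof.
rewrite ge0_integral_even; last 3 first.
- apply/measurable_EFinP; apply: measurable_funM; last exact: measurable_log_tail.
  by apply: (measurableT_comp (measurable_powR _)); exact: normr_measurable.
- by move=> x; rewrite lee_fin mulr_ge0 ?powR_ge0// log_tail_ge0.
- by move=> x; rewrite normrN log_tail_even.
transitivity (2%:E * ((eta - 1) / 4)%:E * (eta - 1)^-1%:E)%E; last first.
  by rewrite -!EFinM; congr (_%:E); field; rewrite subr_eq0 gt_eqF.
rewrite -muleA; congr (_ * _)%E.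
rewrite -(integral_inv_ln_powR eta1) -ge0_integralZl//; last 3 first.
- by apply/measurable_EFinP; exact: measurable_inv_ln_powR.
- move=> x; rewrite /= in_itv/= andbT => ex; rewrite lee_fin.
  exact: inv_ln_powR_ge0.
- by rewrite lee_fin ltW.
rewrite [LHS]integral_mkcond [RHS]integral_mkcond; apply: eq_integral => x _.
rewrite !patchE !mem_setE !in_itv/= !andbT.
have [ex|ex] := leP (expR 1) x.
  have x0 : 0 < x by apply: lt_le_trans ex; exact: expR_gt0.
  rewrite (ltW x0) /log_tail gtr0_norm// ex -EFinM; congr (_%:E).
  rewrite mulrCA; congr (_ * _); rewrite mulrA; congr (_ * _).
  rewrite -powRD; last by rewrite (gt_eqF x0) implybT.
  by rewrite opprD addrA subrr add0r powR_inv1// ltW.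
case: ifPn => // x0; rewrite /log_tail ger0_norm// leNgt ex mulr0//.
Qed.

Lemma log_tail_moment_le (r : R) : 0 <= r -> r <= s ->
  (\int[mu]_x (`|x| `^ r * log_tail x)%:E <= 2^-1%:E)%E.
Proof.
move=> r0 rs; rewrite -integral_log_tail_powR.
have mn a : measurable_fun setT (fun x : R => (`|x| `^ a * log_tail x)%:E).
  apply/measurable_EFinP; apply: measurable_funM; last exact: measurable_log_tail.
  by apply: (measurableT_comp (measurable_powR _)); exact: normr_measurable.
apply: ge0_le_integral => //.
- by move=> x _; rewrite lee_fin mulr_ge0 ?powR_ge0// log_tail_ge0.
- exact: mn.
- exact: mn.
- move=> x _; rewrite lee_fin /log_tail; case: ifPn => [ex|_]; last by rewrite !mulr0.
  apply: ler_wpM2r.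
    by apply: mulr_ge0; [exact: ltW|rewrite mulr_ge0 ?powR_ge0].
  by apply: ler_powR => //; apply: le_trans ex; rewrite -expR0 ler_expR.
Qed.

(** The function decreases beyond [exp 1], so its integral over []t, 2 t]] is at least [t] times its
    value at [2 t]. *)
Lemma log_tail_lower (t : R) : expR 1 <= t ->
  (((eta - 1) / 4 * (t * ((2 * t) `^ (- (s + 1)) * (ln (2 * t)) `^ (- eta))))%:E <=
  \int[mu]_(x in `]t, +oo[) (log_tail x)%:E)%E.
Proof.
move=> et; have [s2' eta1'] := (s2, eta1).
have t0 : 0 < t by apply: lt_le_trans et; exact: expR_gt0.
have mt A : measurable_fun A (fun x : R => (log_tail x)%:E).
  by apply: measurable_funTS; apply/measurable_EFinP; exact: measurable_log_tail.
set c := (2 * t) `^ _ * _.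
have -> : ((eta - 1) / 4 * (t * c) = (eta - 1) / 4 * c * t)%R by rewrite mulrA mulrAC.
have -> : ((eta - 1) / 4 * c * t)%:E =
    (\int[mu]_(x in `]t, (2 * t)%R]) ((eta - 1) / 4 * c)%:E)%E.
  rewrite integral_cst//= lebesgue_measure_itv/= lte_fin ltr_pMl// ltr1n.
  by rewrite -EFinB -EFinM; congr (_%:E); ring.
apply: (@le_trans _ _ (\int[mu]_(x in `]t, (2 * t)%R]) (log_tail x)%:E)%E); last first.
  apply: ge0_subset_integral => //; first exact: mt.
    by move=> x _; rewrite lee_fin log_tail_ge0.
  exact: subset_itvl.
apply: ge0_le_integral => //.
- move=> x _; rewrite lee_fin; apply: mulr_ge0; first exact: ltW.
  by rewrite mulr_ge0 ?powR_ge0.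
- exact: mt.
move=> x /=; rewrite in_itv/= => /andP[tx xt].
have x0 : 0 < x by exact: lt_trans tx.
have ex : expR 1 <= x by apply: le_trans (ltW tx).
have lx : 0 < ln x by apply: ln_gt0; apply: lt_le_trans ex; rewrite -expR0 ltr_expR.
rewrite lee_fin /log_tail gtr0_norm// ex ler_pM2l//.
have t20 : 0 < 2 * t by exact: mulr_gt0.
have s10 : 0 <= s + 1 by lra.
have eta0 : 0 <= eta by lra.
have lxt : ln x <= ln (2 * t) by rewrite ler_ln ?posrE.
have lt0 : 0 < ln (2 * t) by exact: lt_le_trans lxt.
rewrite ler_pM ?powR_ge0// !powRN lef_pV2 ?posrE ?powR_gt0//.
- by apply: ge0_ler_powR => //; rewrite nnegrE ltW.
- by apply: ge0_ler_powR => //; rewrite nnegrE ltW.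
Qed.

End log_tail.

Section heavy_density.
Context {R : realType}.
Local Notation mu := (@lebesgue_measure R).

(* [log_tail] carries mass and second moment at most 1/2 each; a uniform bulk on
   [[- b, b]] restores total mass 1 and variance 1. *)
Lemma heavy_tailed_density (eta s : R) : 1 < eta -> 2 < s ->
  exists p : R -> R, [/\ measurable_fun setT p, forall x, 0 <= p x,
    (forall x, p (- x) = p x) & exists M : R, forall x, p x <= M] /\
  [/\ (\int[mu]_x (p x)%:E = 1)%E,
      (\int[mu]_x (x ^+ 2 * p x)%:E = 1)%E,
      (\int[mu]_x (`|x| `^ s * p x)%:E < +oo)%E &
      forall t, expR 1 <= t ->
      (((eta - 1) / 4 * (t * ((2 * t) `^ (- (s + 1)) * (ln (2 * t)) `^ (- eta))))%:E
         <= \int[mu]_(x in `]t, +oo[) (p x)%:E)%E].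
Proof.
move=> eta1 s2; pose g := log_tail eta s.
have g0 x : 0 <= g x by exact: log_tail_ge0.
have mg : measurable_fun setT g by exact: measurable_log_tail.
have mS (h : R -> R) : measurable_fun setT h ->
    measurable_fun setT (fun x => (h x * g x)%:E).
  by move=> mh; apply/measurable_EFinP; exact: measurable_funM.
have m2 : measurable_fun setT (fun x : R => x ^+ 2) by exact: exprn_measurable.
have ms : measurable_fun setT (fun x : R => `|x| `^ s).
  by apply: (measurableT_comp (measurable_powR _)); exact: normr_measurable.
have hm : (\int[mu]_x (g x)%:E <= 2^-1%:E)%E.
  have s0 : 0 <= s by lra.
  have := log_tail_moment_le eta1 (lexx 0) s0.
  by under eq_integral do rewrite powRr0 mul1r.
have hv : (\int[mu]_x (x ^+ 2 * g x)%:E <= 2^-1%:E)%E.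
  have -> : (\int[mu]_x (x ^+ 2 * g x)%:E = \int[mu]_x (`|x| `^ 2 * g x)%:E)%E.
    by apply: eq_integral => x _; rewrite powR_mulrn// real_normK// num_real.
  by apply: log_tail_moment_le => //; exact: ltW.
have hs := integral_log_tail_powR s eta1.
have fin_val (h : R -> R) : (forall x, 0 <= h x) ->
    (\int[mu]_x (h x * g x)%:E <= 2^-1%:E)%E ->
    exists2 m : R, (\int[mu]_x (h x * g x)%:E = m%:E)%E & 0 <= m <= 2^-1.
  move=> h0 hle; have i0 : (0 <= \int[mu]_x (h x * g x)%:E)%E.
    by apply: integral_ge0 => x _; rewrite lee_fin mulr_ge0.
  have ifin : (\int[mu]_x (h x * g x)%:E)%E \is a fin_num.
    by rewrite ge0_fin_numE// (le_lt_trans hle)// ltry.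
  exists (fine (\int[mu]_x (h x * g x)%:E)%E); first by rewrite fineK.
  by rewrite fine_ge0//= -lee_fin fineK.
have [m mE m01] : exists2 m : R, (\int[mu]_x (1 * g x)%:E = m%:E)%E & 0 <= m <= 2^-1.
  by apply: (fin_val (cst 1)) => //; under eq_integral do rewrite mul1r.
have [v vE v01] := fin_val (fun x => x ^+ 2) (fun x => sqr_ge0 x) hv.
(* [b] and [beta] solve [2 b beta = 1 - m] for the missing mass and [2 beta b^3 / 3 = 1 - v] for the
   missing second moment; both right sides are at least 1/2. *)
pose b := Num.sqrt (3 * (1 - v) / (1 - m)).
have b2 : b ^+ 2 = 3 * (1 - v) / (1 - m).
  by rewrite sqr_sqrtr// divr_ge0//; lra.
have b0 : 0 < b by rewrite sqrtr_gt0 divr_gt0//; lra.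
pose beta := (1 - m) / (2 * b).
have beta0 : 0 < beta by rewrite divr_gt0//; lra.
pose u x := beta * \1_(`[(- b), b] : set R) x.
have u0 x : 0 <= u x by rewrite mulr_ge0// ltW.
have mbulk : measurable_fun setT u by apply: measurable_funM => //; exact: measurable_indic.
pose p x := g x + u x.
have splitE (h : R -> R) : measurable_fun setT h -> (forall x, 0 <= h x) ->
    (\int[mu]_x (h x * p x)%:E = \int[mu]_x (h x * g x)%:E +
      beta%:E * \int[mu]_(x in `[(- b)%R, b]) (h x)%:E)%E.
  move=> mh h0.
  under eq_integral do rewrite /p mulrDr EFinD.
  rewrite ge0_integralD//; last 4 first.
  - by move=> x _; rewrite lee_fin mulr_ge0.
  - exact: mS.
  - by move=> x _; rewrite lee_fin mulr_ge0.
  - by apply/measurable_EFinP; exact: measurable_funM.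
  congr (_ + _)%E; rewrite -ge0_integralZl//; last 3 first.
  - by apply: measurable_funTS; exact/measurable_EFinP.
  - by move=> x _; rewrite lee_fin.
  - by rewrite lee_fin ltW.
  rewrite [RHS]integral_mkcond; apply: eq_integral => x _.
  rewrite patchE /u indicE; case: ifPn => xb /=; last by rewrite !mulr0.
  by rewrite mulr1 -EFinM mulrC.
have mub : mu `[(- b)%R, b]%classic = (2 * b)%:E.
  rewrite lebesgue_measure_itv/= lte_fin (_ : - b < b); last by lra.
  by rewrite -EFinB opprK mulr_natl mulr2n.
exists p; split.
  split=> [|x|x|].
  - exact: measurable_funD.
  - exact: addr_ge0.
  - rewrite /p /g log_tail_even /u !indicE; congr (_ + _ * _%:R).
    by congr (nat_of_bool _); rewrite !mem_setE !in_itv/= -!ler_norml normrN.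
  - exists ((eta - 1) / 4 + beta) => x; apply: lerD; first exact: log_tail_le.
    by rewrite /u ler_piMr ?(ltW beta0)// indicE; case: (_ \in _).
have nz : 1 - m != 0 by rewrite gt_eqF//; lra.
have bnz : b != 0 by rewrite gt_eqF.
split.
- have -> : (\int[mu]_x (p x)%:E = \int[mu]_x (cst 1 x * p x)%:E)%E.
    by apply: eq_integral => x _; rewrite mul1r.
  rewrite splitE// [X in (X + _)%E]mE.
  have -> : (\int[mu]_(x in `[(- b)%R, b]) (cst 1 x)%:E = (2 * b)%:E)%E.
    by rewrite (integral_cst mu _ 1)// mul1e.
  by rewrite -EFinM -EFinD; congr (_%:E); rewrite /beta; field.
- rewrite splitE//; last by move=> x; exact: sqr_ge0.
  rewrite vE integral_sqr_sym// -EFinM -EFinD; congr (_%:E).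
  have -> : beta * (2 * b ^+ 3 / 3) = (1 - m) * b ^+ 2 / 3.
    by rewrite /beta exprS; field.
  by rewrite b2; field.
- rewrite splitE//.
  rewrite [X in (X + _)%E]hs lte_add_pinfty ?ltry// lte_mul_pinfty ?lee_fin ?(ltW beta0)//.
  apply: (@le_lt_trans _ _ (\int[mu]_(x in `[(- b)%R, b]) (b `^ s)%:E)%E).
    apply: ge0_le_integral => //.
    - by apply: measurable_funTS; exact/measurable_EFinP.
    - move=> x /=; rewrite in_itv/= => xb; rewrite lee_fin.
      apply: ge0_ler_powR; rewrite ?nnegrE ?(ltW b0)//; first by lra.
      by rewrite ler_norml.
  by rewrite integral_cst//= [X in (_ * X)%E]mub -EFinM ltry.
- move=> t et; apply: (le_trans (log_tail_lower eta1 s2 et)).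
  apply: ge0_le_integral => //.
  - by move=> x _; rewrite lee_fin.
  - by apply: measurable_funTS; exact/measurable_EFinP.
  - by apply: measurable_funTS; apply/measurable_EFinP; exact: measurable_funD.
  - by move=> x _; rewrite lee_fin lerDl.
Qed.

End heavy_density.

(** * The rate of convergence *)

Section rates.
Context {R : realType}.

(** With [y = n^(1 / (2 a))], [ln n = 2 a ln y <= 2 a y], so [(ln n)^a] is at most a constant times
    [sqrt n]; the remaining [sqrt n] absorbs [B]. *)
Lemma powR_ln_little_o (K a : R) : 0 <= K -> 0 < a ->
  exists n0 : nat, forall n, (n0 <= n)%N -> (0 < n)%N -> K * ln n%:R `^ a <= n%:R :> R.
Proof.
move=> K0 a0; pose B := K * (2 * a) `^ a.
have B0 : 0 <= B by rewrite mulr_ge0// powR_ge0.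
exists (Num.bound (B ^+ 2)) => n n0n n_gt0.
have n0 : 0 < n%:R :> R by rewrite ltr0n.
have n1 : 1 <= n%:R :> R by rewrite ler1n.
have B2n : B ^+ 2 <= n%:R.
  by apply: (le_trans (ltW (archi_boundP (sqr_ge0 B)))); rewrite ler_nat.
have Bn : B <= Num.sqrt n%:R.
  by rewrite -(ger0_norm B0) -sqrtr_sqr ler_sqrt// ltW.
pose y : R := n%:R `^ (2 * a)^-1.
have y0 : 0 < y by exact: powR_gt0.
have a20 : 0 < 2 * a by exact: mulr_gt0.
have ly : ln n%:R = 2 * a * ln y.
  by rewrite /y ln_powR mulrA divff ?mul1r// gt_eqF.
have lny : ln n%:R <= 2 * a * y.
  by rewrite ly ler_pM2l// ltW// ln_sublinear.
have ya : y `^ a = Num.sqrt n%:R.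
  rewrite /y -powRrM -powR12_sqrt ?ltW//; congr (_ `^ _).
  by rewrite invfM -mulrA mulVf ?mulr1// gt_eqF.
have h : ln n%:R `^ a <= (2 * a) `^ a * Num.sqrt n%:R.
  rewrite -ya -(powRM _ (ltW a20) (ltW y0)).
  apply: ge0_ler_powR => //; rewrite ?nnegrE; first exact: ltW.
    by rewrite ln_ge0.
  by rewrite mulr_ge0 ?ltW.
apply: (le_trans (ler_wpM2l K0 h)); rewrite mulrA -/B.
by rewrite -[leRHS](sqr_sqrtr (ltW n0)) expr2 ler_wpM2r// sqrtr_ge0.
Qed.

(** Here [N] stands for [n] and [q] for the one-sided tail at [t]. The 16 in [c] is 4 from the
    density, 2 from [t / (2 t)] and 2 from the big jump. The last lower bound on [N] makes the error
    at most half of the main term. *)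
Lemma entropy_rate (eta s N q : R) : 1 < eta -> 2 < s -> s < 4 ->
  let l := ln N in let c := (eta - 1) / (16 * 48 ^+ 2) in let t := Num.sqrt (12 * (N * l)) in
  0 < N -> 1 <= l -> 48 * l <= N -> 4 / c * l `^ (1 + eta) <= N ->
  (eta - 1) / 4 * (t * ((2 * t) `^ (- (s + 1)) * (ln (2 * t)) `^ (- eta))) <= q ->
  c / 2 / ((N * l) `^ ((s - 2) / 2) * l `^ eta) <=
    l * (N * q / 2) - Num.sqrt 2 * expR (l - Num.sqrt (12 * l) ^+ 2 / 4).
Proof.
move=> eta1 s2 s4 l c t N0 l1 lN cN hq.
have lE : expR l = N by exact: lnK.
have cE : c = (eta - 1) / (16 * 48 ^+ 2) by [].
have tE : t ^+ 2 = 12 * (N * l).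
  by rewrite sqr_sqrtr// !mulr_ge0 ?(ltW N0)// (le_trans ler01).
have t0 : 0 < t by rewrite sqrtr_gt0 !mulr_gt0// (lt_le_trans ltr01).
have ln_le x : 0 < x -> x <= N -> ln x <= l by move=> x0 xN; rewrite ler_ln.
clearbody t; clearbody c; clearbody l.
have l0 : 0 < l by lra.
pose A := N * l; have A0 : 0 < A by exact: mulr_gt0.
have c0 : 0 < c by rewrite cE divr_gt0 ?subr_gt0// mulr_gt0// exprn_gt0.
have N1 : 1 <= N by lra.
have A1 : 1 <= A.
  by rewrite /A -[leLHS]mulr1 ler_pM.
pose X := A `^ ((s - 2) / 2); have X0 : 0 < X by exact: powR_gt0.
pose Y := l `^ eta; have Y0 : 0 < Y by exact: powR_gt0.
rewrite -/A -/X -/Y.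
have t2 : (2 * t) ^+ 2 = 48 * A.
  by rewrite exprMn tE /A; ring.
have t20 : 0 < 2 * t by exact: mulr_gt0.
have XA : A `^ (s / 2) = A * X.
  rewrite -{2}(powRr1 (ltW A0)) /X -powRD; last by rewrite (gt_eqF A0) implybT.
  by congr (_ `^ _); field.
have ts : (2 * t) `^ s = 48 `^ (s / 2) * (A * X).
  rewrite -XA -powRM ?(ltW A0)// -t2 -powR_mulrn ?(ltW t20)// -powRrM.
  by congr (_ `^ _); field.
have p48 : 48 `^ (s / 2) <= 48 ^+ 2 :> R.
  rewrite -powR_mulrn//; apply: ler_powR; [lra|lra].
have h1 : t * (2 * t) `^ (- (s + 1)) >= 2^-1 * (48 ^+ 2 * (A * X))^-1.
  have -> : t * (2 * t) `^ (- (s + 1)) = 2^-1 * ((2 * t) `^ s)^-1.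
    rewrite powRN powRD; last by rewrite (gt_eqF t20) implybT.
    rewrite powRr1 ?(ltW t20)//; field.
    by rewrite (gt_eqF t0) gt_eqF// powR_gt0.
  rewrite ler_pM2l// lef_pV2 ?posrE ?powR_gt0//; last by rewrite !mulr_gt0// exprn_gt0.
  by rewrite ts ler_pM2r// mulr_gt0.
have lt0 : 0 < ln (2 * t).
  apply: ln_gt0; rewrite -(ltr_pXn2r (n := 2)) ?nnegrE ?(ltW t20)//.
  by rewrite t2 expr1n; lra.
(* [(2 t)^2 = 48 N l <= N^2], hence [2 t <= N]. *)
have ltl : ln (2 * t) <= l.
  apply: ln_le => //; rewrite -(ler_pXn2r (n := 2)) ?nnegrE ?(ltW t20) ?(ltW N0)//.
  by rewrite t2 /A mulrCA expr2 ler_pM2l.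
have h2 : Y^-1 <= ln (2 * t) `^ (- eta).
  rewrite powRN lef_pV2 ?posrE ?powR_gt0//.
  by apply: ge0_ler_powR; rewrite ?nnegrE ?(ltW lt0) ?(ltW l0)//; lra.
have k0 : 0 < (eta - 1) / 4 by rewrite divr_gt0// subr_gt0.
have h3 : (eta - 1) / 4 * (2^-1 * (48 ^+ 2 * (A * X))^-1 * Y^-1) <= q.
  apply: le_trans hq; rewrite ler_pM2l// [leRHS]mulrA.
  apply: ler_pM => //; last by rewrite invr_ge0 ltW.
  by rewrite mulr_ge0// invr_ge0 ltW// !mulr_gt0// exprn_gt0.
have h4 : c / (X * Y) <= l * (N * q / 2).
  have -> : l * (N * q / 2) = A / 2 * q by rewrite /A; field.
  have -> : c / (X * Y) = A / 2 * ((eta - 1) / 4 * (2^-1 * (48 ^+ 2 * (A * X))^-1 * Y^-1)).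
    by rewrite cE; field; rewrite !gt_eqF.
  by rewrite ler_pM2l ?divr_gt0.
have e2 : expR (l - Num.sqrt (12 * l) ^+ 2 / 4) = (N ^+ 2)^-1.
  rewrite sqr_sqrtr; last by rewrite mulr_ge0// ltW.
  have -> : l - 12 * l / 4 = - (l * 2) by field.
  by rewrite expRN expRM_natr lE.
(* Since [s < 4], the exponent [(s - 2) / 2] is at most 1, and [A >= 1]. *)
have XYA : X * Y <= N * l `^ (1 + eta).
  have -> : N * l `^ (1 + eta) = A * Y.
    by rewrite powRD ?(gt_eqF l0) ?implybT// powRr1 ?(ltW l0)// /A mulrA.
  rewrite ler_pM2r// -[leRHS]powRr1 ?(ltW A0)//; apply: ler_powR => //; lra.
have h5 : Num.sqrt 2 * (N ^+ 2)^-1 <= c / 2 / (X * Y).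
  have s22 : Num.sqrt 2 <= 2 :> R.
    rewrite -[leRHS]ger0_norm// -sqrtr_sqr ler_sqrt//; rewrite expr2; lra.
  have N20 : 0 < N ^+ 2 by exact: exprn_gt0.
  apply: (@le_trans _ _ (2 / N ^+ 2)); first by rewrite ler_pM2r// invr_gt0.
  rewrite ler_pdivrMr// mulrAC ler_pdivlMr ?mulr_gt0//.
  apply: (@le_trans _ _ (2 * (N * l `^ (1 + eta)))); first by rewrite ler_pM2l.
  have : l `^ (1 + eta) <= N * c / 4.
    by move: cN; rewrite mulrAC ler_pdivrMr// ler_pdivlMr// mulrC.
  move=> /(ler_wpM2l (ltW N0)) h; rewrite expr2.
  by move: h; lra.
rewrite e2; move: h4 h5.
have -> : c / 2 / (X * Y) = c / (X * Y) / 2 by rewrite mulrAC.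
lra.
Qed.

End rates.

(** * Moments of a variable with a given density *)

Section density_moments.
Context d (T : measurableType d) (R : realType) (P : probability T R).
Local Notation mu := (@lebesgue_measure R).
Variables (X : {RV P >-> R}) (p : R -> R).
Hypothesis Xp : is_density P X p.

Lemma integral_is_density : (\int[mu]_x (p x)%:E = 1)%E.
Proof. by have [_ _ <-] := Xp; rewrite ?preimage_setT ?probability_setT. Qed.

Lemma ge0_expectation_density (g : R -> R) : measurable_fun setT g ->
  (forall x, 0 <= g x) -> ('E_P[g \o X] = \int[mu]_x (g x * p x)%:E)%E.
Proof.
move=> mg g0; have [mp p0 pE] := Xp; rewrite unlock.
have mg' : measurable_fun setT (EFin \o g) by exact/measurable_EFinP.
have [nu nuE] := density_prob mp p0 integral_is_density.
have g0' x : (0 <= (EFin \o g) x)%E by rewrite lee_fin.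
have <- := ge0_integral_density mp p0 integral_is_density nuE mg' g0'.
have mX0 : measurable_fun setT (X : T -> R) by exact: measurable_funP.
have mX : measurable_fun setT (X : T -> measurableTypeR R) by exact: mX0.
have g0'' : {in [set: measurableTypeR R], forall y, (0 <= (EFin \o g) y)%E}.
  by move=> x _; exact: g0'.
have := ge0_integral_pushforward mX P measurableT mg' g0''.
rewrite preimage_setT => <-.
apply: eq_measure_integral => A mA _.
by rewrite [RHS]nuE// -pE.
Qed.

(** Reflection gives the positive and negative parts the same integral [I]. It is finite because
    [max x 0 <= 1 + x^2], so the difference is 0. *)
Lemma expectation_even_density : (forall x, p (- x) = p x) ->
  (\int[mu]_x (x ^+ 2 * p x)%:E < +oo)%E -> ('E_P[X] = 0)%E.
Proof.
move=> pe p2; have [mp p0 pE] := Xp.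
have mm : measurable_fun setT (fun x : R => Num.max x 0) by exact: measurable_maxr.
have mN : measurable_fun setT (fun x : R => Num.max (- x) 0).
  by apply: measurable_maxr => //; exact: oppr_measurable.
have m0 x : 0 <= Num.max x 0 :> R by rewrite le_max lexx orbT.
pose I := (\int[mu]_x (Num.max x 0 * p x)%:E)%E.
have Ip : (\int[P]_w (EFin \o X)^\+ w = I)%E.
  have := ge0_expectation_density mm m0; rewrite unlock /I => <-.
  by apply: eq_integral => w _; rewrite funeposE /= EFin_max.
have In : (\int[P]_w (EFin \o X)^\- w = I)%E.
  have := ge0_expectation_density mN (fun x => m0 (- x)); rewrite unlock => e.
  transitivity (\int[mu]_x (Num.max (- x) 0 * p x)%:E)%E.
    by rewrite -e; apply: eq_integral => w _; rewrite funenegE /= EFin_max.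
  rewrite ge0_integral_oppr//; last 2 first.
  - by apply/measurable_EFinP; exact: measurable_funM.
  - by move=> x; rewrite lee_fin mulr_ge0.
  by rewrite preimage_setT; apply: eq_integral => x _; rewrite opprK pe.
have Ifin : I \is a fin_num.
  rewrite ge0_fin_numE; last by apply: integral_ge0 => x _; rewrite lee_fin mulr_ge0.
  apply: (@le_lt_trans _ _ (\int[mu]_x ((p x)%:E + (x ^+ 2 * p x)%:E))%E).
    apply: ge0_le_integral => //.
    - by move=> x _; rewrite lee_fin mulr_ge0.
    - by apply/measurable_EFinP; exact: measurable_funM.
    - apply/measurable_EFinP; apply: measurable_funD => //.
      by apply: measurable_funM => //; exact: exprn_measurable.
    - move=> x _; rewrite -EFinD lee_fin -{2}[p x]mul1r -mulrDl.
      by apply: ler_wpM2r => //; rewrite ge_max; apply/andP; split; nra.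
  rewrite ge0_integralD//.
  - by rewrite integral_is_density lte_add_pinfty// ltry.
  - by move=> x _; rewrite lee_fin.
  - exact/measurable_EFinP.
  - by move=> x _; rewrite lee_fin mulr_ge0// ?sqr_ge0.
  - by apply/measurable_EFinP; apply: measurable_funM => //; exact: exprn_measurable.
by rewrite unlock integralE Ip In subee.
Qed.

End density_moments.

(** * Assembling the example *)

Theorem theorem1p3 (R : realType) (eta : R) (heta : 1 < eta) :
  exists c : R, 0 < c /\
  forall s : R, 2 < s -> s < 4 ->
  exists (d : measure_display) (T : measurableType d) (P : probability T R)
         (X : nat -> {RV P >-> R}),
    iid P (fun i => (X i : T -> R)) /\
        ('E_P[X 0%N] = 0)%E /\
        ('E_P[fun w => (X 0%N w ^+ 2)%R] = 1)%E /\
        ('E_P[fun w => (`|X 0%N w| `^ s)%R] < +oo)%E /\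
        (D P (X 0%N) < +oo)%E /\
        (exists n1 : nat, forall n : nat, (n1 <= n)%N ->
          ((c / ((n%:R * ln n%:R) `^ ((s - 2) / 2) * (ln n%:R) `^ eta))%:E
             <= D P (normalized_sum (fun i => (X i : T -> R)) n))%E).
Proof.
pose c := (eta - 1) / (16 * 48 ^+ 2).
have c0 : 0 < c by rewrite divr_gt0 ?subr_gt0// mulr_gt0// exprn_gt0.
exists (c / 2); split=> [|s s2 s4]; first by rewrite divr_gt0.
have [p [[mp p0 pe [M pM]] [p1 p2 ps ptail]]] := heavy_tailed_density heta s2.
have [nu nuE] := density_prob mp p0 p1.
have [d [T [P [X [iidX X0]]]]] := exists_iid_sequence nu.
have Xp : is_density P (X 0%N) p by split=> // A mA; rewrite X0// nuE.
have p2y : (\int[lebesgue_measure]_x (x ^+ 2 * p x)%:E < +oo)%E by rewrite p2 ltry.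
have E0 : ('E_P[X 0%N] = 0)%E := expectation_even_density Xp pe p2y.
have m2 : measurable_fun setT (fun x : R => x ^+ 2) by exact: exprn_measurable.
have ms : measurable_fun setT (fun x : R => `|x| `^ s).
  by apply: (measurableT_comp (measurable_powR _)); exact: normr_measurable.
have E2 : ('E_P[fun w => (X 0%N w ^+ 2)%R] = 1)%E.
  by rewrite -p2 -(ge0_expectation_density Xp m2)// => x; exact: sqr_ge0.
exists d, T, P, X; split=> //; split=> //; split=> //; split; last split.
- by rewrite (ge0_expectation_density Xp ms)// => x; exact: powR_ge0.
- have V1 : ('V_P[X 0%N] = 1)%E.
    rewrite varianceE; last exact: (iid_Lfun2 iidX E2 0%N).
    by rewrite E0 -[LHS]/(_ - 0 * 0)%E mule0 sube0 -E2.
  rewrite /D E0 V1 /= sqrtr1.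
  apply: (@le_lt_trans _ _ (rel_entropy_normal p 0 1)).
    by apply: ereal_inf_lbound; exists p.
  apply: (@rel_entropy_normal_lty _ _ M) => //; last by rewrite p1 ltry.
  by move=> x; rewrite p0 pM.
have [na hna] := @powR_ln_little_o R 48 1 (ler0n _ _) ltr01.
have eta0 : 0 < 1 + eta by lra.
have c40 : 0 <= 4 / c by rewrite divr_ge0// ltW.
have [nb hnb] := powR_ln_little_o c40 eta0.
(* [na] gives [48 log n <= n], [nb] lets the [n^-2] error be absorbed, and [(exp 1)^2 <= n] yields
   both [log n >= 1] and [t >= exp 1], where the tail estimate applies. *)
exists (maxn na (maxn nb (maxn (Num.bound ((expR 1 : R) ^+ 2)) 1))) => n.
rewrite !geq_max => /and4P[nna nnb nnc n_gt0].
set N : R := n%:R; set l := ln N.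
have N0 : 0 < N by rewrite ltr0n.
have e1 : 1 <= expR 1 :> R by rewrite -expR0 ler_expR.
have eN2 : (expR 1) ^+ 2 <= N.
  by apply: (le_trans (ltW (archi_boundP (sqr_ge0 (expR 1 : R))))); rewrite ler_nat.
have eN : expR 1 <= N by apply: le_trans eN2; rewrite expr2 ler_peMr// expR_ge0.
have l1 : 1 <= l by rewrite -[leLHS]expRK ler_ln ?posrE ?expR_gt0.
have l0 : 0 < l by exact: lt_le_trans l1.
have h48 : 48 * l <= N by have := hna n nna n_gt0; rewrite powRr1// ltW.
have hc := hnb n nnb n_gt0.
pose t := Num.sqrt (12 * (N * l)).
have t2 : t ^+ 2 = 12 * (N * l) by rewrite sqr_sqrtr// !mulr_ge0// ltW.
have t0 : 0 < t by rewrite sqrtr_gt0 !mulr_gt0.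
have Nl : N <= N * l by rewrite ler_peMr// ltW.
have et : expR 1 <= t.
  rewrite -(ler_pXn2r (n := 2)) ?nnegrE ?expR_ge0 ?(ltW t0)// t2.
  by apply: (le_trans eN2); apply: (le_trans Nl); rewrite ler_peMl ?ler1n// mulr_ge0// ltW.
have mtp A : measurable_fun A (fun x : R => (p x)%:E).
  by apply: measurable_funTS; exact/measurable_EFinP.
pose Q := (\int[lebesgue_measure]_(x in `]t, +oo[) (p x)%:E)%E.
have Qge0 : (0 <= Q)%E by apply: integral_ge0 => x _; rewrite lee_fin.
have Qle1 : (Q <= 1)%E.
  rewrite -p1; apply: ge0_subset_integral => //; first exact: mtp.
  by move=> x _; rewrite lee_fin.
pose q := fine Q.
have qE : Q = q%:E by rewrite fineK// ge0_fin_numE// (le_lt_trans Qle1)// ltry.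
have q0 : 0 <= q by exact: fine_ge0.
have [_ _ XpE] := Xp.
have Pp : P [set w | t < X 0%N w] = q%:E.
  rewrite -qE /Q -XpE//; congr (P _).
  by apply/seteqP; split=> w /=; rewrite in_itv/= andbT.
have Pm : P [set w | X 0%N w < - t] = q%:E.
  rewrite -qE /Q ge0_integral_oppr//.
  rewrite (_ : -%R @^-1` _ = `]-oo, - t[%classic); last first.
    by apply/seteqP; split=> x /=; rewrite !in_itv/= andbT ltrNr.
  under eq_integral do rewrite pe.
  by rewrite -XpE.
(* Chebyshev's inequality with unit second moment; as [t^2 = 12 n log n], it gives [n q <= 1/12],
   small enough for the big jump estimate. *)
have qt : t ^+ 2 * q <= 1.
  rewrite -lee_fin EFinM -qE /Q -p2 -ge0_integralZl//; last 3 first.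
  - exact: mtp.
  - by move=> x _; rewrite lee_fin.
  - by rewrite lee_fin sqr_ge0.
  apply: (@le_trans _ _ (\int[lebesgue_measure]_(x in `]t, +oo[) (x ^+ 2 * p x)%:E)%E).
    apply: ge0_le_integral => //.
    - by move=> x _; rewrite -EFinM lee_fin mulr_ge0// sqr_ge0.
    - by apply: emeasurable_funM => //; exact: mtp.
    - by apply: measurable_funTS; apply/measurable_EFinP; exact: measurable_funM.
    - move=> x /=; rewrite in_itv/= andbT => tx; rewrite -EFinM lee_fin ler_wpM2r//.
      by rewrite ler_sqr ?nnegrE ltW// (lt_trans t0).
  apply: ge0_subset_integral => //; first by apply/measurable_EFinP; exact: measurable_funM.
  by move=> x _; rewrite lee_fin mulr_ge0// sqr_ge0.
have nq : N * (2 * q) <= 2^-1.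
  have : N * q <= 12^-1.
    have : 12 * (N * q) <= 1.
      apply: le_trans qt; rewrite t2 -!mulrA ler_pM2l// ler_pM2l//.
      by rewrite ler_peMl.
    by lra.
  by rewrite mulrCA; lra.
have jump := big_jump iidX (ltW t0) Pp Pm nq.
have [EZ VZ] := normalized_sum_moments iidX E0 E2 n_gt0.
rewrite /D EZ VZ /= sqrtr1; apply: le_ereal_inf_tmp => _ [r [mr r0 rE] <-].
have r1 : (\int[lebesgue_measure]_x (r x)%:E = 1)%E.
  by rewrite -rE// preimage_setT probability_setT.
apply: le_trans (rel_entropy_normal_tail_bound l mr r0 r1 (sqrtr_ge0 (12 * l))).
have ht : (((eta - 1) / 4 * (t * ((2 * t) `^ (- (s + 1)) * (ln (2 * t)) `^ (- eta)))) <= q)%R.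
  by rewrite -lee_fin -qE; exact: ptail.
have := entropy_rate heta s2 s4 N0 l1 h48 hc ht; rewrite -/l -/c => rate.
apply: (@le_trans _ _ (l * (N * q / 2) -
    Num.sqrt 2 * expR (l - Num.sqrt (12 * l) ^+ 2 / 4))%:E); first by rewrite lee_fin.
rewrite EFinB leeB// EFinM lee_pmul2l ?lte_fin//.
rewrite -rE; last by apply: measurable_set_ltr => //; exact: normr_measurable.
rewrite (_ : _ @^-1` _ = [set w | (t < `|\sum_(i < n) X i w|)%R])//.
have sN : 0 < Num.sqrt N by rewrite sqrtr_gt0.
have tE : t = Num.sqrt (12 * l) * Num.sqrt N.
  by rewrite -sqrtrM ?mulr_ge0 ?(ltW l0)// /t; congr Num.sqrt; ring.
by apply/seteqP; split=> w /=; rewrite /normalized_sum normf_div (gtr0_norm sN)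
  ltr_pdivlMr// tE.
Qed.
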